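(* Let $\phi$ be an admissible action density and $\gamma\in\mathcal M^+_{\rm loc}(\mathbb R^d)$. Let $\mu_i=s_i\gamma\in\mathcal M^+_{\rm loc}(\mathbb R^d)$, $i=0,1$, with $s_i\ge L>0$ $\gamma$-a.e. Then there is a constant $C_L$ depending only on $L$ and $\phi$ such that $$\mathcal W_{\phi,\gamma}(\mu_0,\mu_1)\le C_L\,\|\mu_0-\mu_1\|_{\dot W^{-1,p}_\gamma}.$$
   Context: Notation: $\mathcal M^+_{\rm loc}(\mathbb R^d)$ is the set of nonnegative Radon measures on $\mathbb R^d$ and $\mathcal M_{\rm loc}(\mathbb R^d;\mathbb R^d)$ the set of $\mathbb R^d$-valued Radon measures, both endowed with the weak$^*$ topology induced by duality with compactly supported continuous functions; $|\boldsymbol\nu|$ is the total variation measure of $\boldsymbol\nu$; $B_R$ is the open ball of radius $R$ centered at $0$; $p\in(1,\infty)$ and $q=p/(p-1)$. An admissible action density is a function $\phi:(0,\infty)\times\mathbb R^d\to[0,\infty)$ which is convex, satisfies $\phi(\rho,\lambda w)=|\lambda|^p\phi(\rho,w)$ for all $\rho>0,\lambda\in\mathbb R,w\in\mathbb R^d$, and for which there is $\rho_0>0$ with $\phi(\rho_0,w)>0$ for all $w\ne0$. It is extended to $\rho=0$ by $\phi(0,w):=\lim_{\rho\downarrow0}\phi(\rho,w)\in[0,\infty]$ (the map $\rho\mapsto\phi(\rho,w)$ is nonincreasing), and its recession function is $\phi^\infty(\rho,w):=\lim_{\lambda\to+\infty}\lambda^{-1}\phi(\lambda\rho,\lambda w)\in[0,\infty]$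 for $\rho\ge0$. Action functional: given $\gamma\in\mathcal M^+_{\rm loc}(\mathbb R^d)$, $\mu\in\mathcal M^+_{\rm loc}(\mathbb R^d)$, $\boldsymbol\nu\in\mathcal M_{\rm loc}(\mathbb R^d;\mathbb R^d)$ with $\mathrm{supp}\,\mu,\mathrm{supp}\,\boldsymbol\nu\subset\mathrm{supp}\,\gamma$, write the Lebesgue decompositions $\mu=\rho\gamma+\mu^\perp$, $\boldsymbol\nu=w\gamma+\boldsymbol\nu^\perp$, pick any $\sigma\in\mathcal M^+_{\rm loc}(\mathbb R^d)$ with $\mu^\perp=\rho^\perp\sigma$, $\boldsymbol\nu^\perp=w^\perp\sigma$, and set $\Phi(\mu,\boldsymbol\nu|\gamma):=\int\phi(\rho,w)\,d\gamma+\int\phi^\infty(\rho^\perp,w^\perp)\,d\sigma$ (independent of $\sigma$); set $\Phi(\mu,\boldsymbol\nu|\gamma)=+\infty$ if the support condition fails. Continuity equation: for $T>0$, $\mathrm{CE}(0,T)$ is the set of pairs $(\mu,\boldsymbol\nu)$ where $(\mu_t)_{t\in[0,T]}$ is a weakly$^*$ continuous curve in $\mathcal M^+_{\rm loc}(\mathbb R^d)$, $(\boldsymbol\nu_t)_{t\in(0,T)}$ is a Borel family in $\mathcal M_{\rm loc}(\mathbb R^d;\mathbb R^d)$ with $\int_0^T|\boldsymbol\nu_t|(B_R)\,dt<\infty$ for all $R>0$, and $\int_0^T\!\int\partial_t\zeta\,d\mu_t\,dt+\int_0^T\!\int\nabla_x\zeta\cdot d\boldsymbol\nu_t\,dt=0$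 for all $\zeta\in C^1_c(\mathbb R^d\times(0,T))$; $\mathrm{CE}(0,T;\sigma\to\eta)$ is the subset with $\mu_0=\sigma$, $\mu_T=\eta$. Weighted Wasserstein distance: $\mathcal W_{\phi,\gamma}(\mu_0,\mu_1):=\big(\inf\{\int_0^1\Phi(\mu_t,\boldsymbol\nu_t|\gamma)\,dt:(\mu,\boldsymbol\nu)\in\mathrm{CE}(0,1;\mu_0\to\mu_1)\}\big)^{1/p}\in[0,\infty]$. The homogeneous dual Sobolev (pseudo-)norm is $\|\mu_0-\mu_1\|_{\dot W^{-1,p}_\gamma}:=\sup\{\int\zeta\,d(\mu_0-\mu_1):\zeta\in C^1_c(\mathbb R^d),\ \int|\nabla\zeta|^q\,d\gamma\le1\}\in[0,\infty]$. *)

(* Defs.v *)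
From HB Require Import structures.
From mathcomp Require Import all_boot all_order all_algebra.
From mathcomp Require Import all_classical all_reals all_analysis.

Set Implicit Arguments.
Unset Strict Implicit.
Unset Printing Implicit Defensive.

Import Order.TTheory GRing.Theory Num.Theory.
Import numFieldNormedType.Exports.

Local Open Scope classical_set_scope.
Local Open Scope ring_scope.

Section Defs.
Variables (R : realType) (d : nat).

Local Notation V := 'rV[R]_d.

Definition Rd : measurableType _ := g_sigma_algebraType (@open V).

Local Notation meas := {measure set Rd -> \bar R}.

Definition dotv (u v : V) : R := \sum_(i < d) u ord0 i * v ord0 i.
Definition enorm (u : V) : R := Num.sqrt (dotv u u).

Definition eball (x : V) (r : R) : set Rd := [set y : V | enorm (y - x) < r].

(** nonnegative Radon measures on R^d = locally finite Borel measures *)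
Definition locfin (m : meas) : Prop :=
  forall r : R, (m (eball 0 r) < +oo)%E.

Definition oitv (T : R) : set R := `]0, T[%classic.

Definition Cc (f : V -> R) : Prop :=
  continuous f /\ exists K : set V, compact K /\ forall x, ~ K x -> f x = 0.
Definition Ccv (f : V -> V) : Prop :=
  continuous f /\ exists K : set V, compact K /\ forall x, ~ K x -> f x = 0.

Definition ei (i : 'I_d) : V := delta_mx ord0 i.
Definition pd (f : V -> R) (i : 'I_d) (x : V) : R := derive f x (ei i).
Definition grad (f : V -> R) (x : V) : V := \row_i pd f i x.

Definition C1c (f : V -> R) : Prop :=
  Cc f /\ (forall x i, derivable f x (ei i)) /\ (forall i, continuous (pd f i)).

Definition C1c_st (T : R) (z : V -> R -> R) : Prop :=
  continuous (fun p : V * R => z p.1 p.2) /\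
  (exists K : set (V * R), compact K /\ K `<=` [set p | 0 < p.2 < T] /\
     forall p, ~ K p -> z p.1 p.2 = 0) /\
  (forall x t i, derivable (fun y => z y t) x (ei i)) /\
  (forall i, continuous (fun p : V * R => pd (fun y => z y p.2) i p.1)) /\
  (forall x t, derivable (z x) t 1) /\
  continuous (fun p : V * R => derive (z p.1) p.2 1).

(** R^d-valued Radon measures, represented as [vdens * vbase] with a
    locally [vbase]-integrable Borel density (every such measure has this form,
    e.g. with vbase = |nu| and the polar density) *)
Record vmeas := VMeas {
  vbase : meas;
  vdens : V -> V;
  vdens_meas : forall i, measurable_fun [set: Rd] (fun x : Rd => vdens x ord0 i);
  vdens_loc : forall r : R,
    (\int[vbase]_(x in eball 0 r) (enorm (vdens x))%:E < +oo)%E }.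

Definition vint (nu : vmeas) (f : V -> V) : R :=
  Rintegral (vbase nu) [set: Rd] (fun x : Rd => dotv (vdens nu x) (f x)).

Definition tv (nu : vmeas) (A : set Rd) : \bar R :=
  (\int[vbase nu]_(x in A) (enorm (vdens nu x))%:E)%E.

Definition supp (m : set Rd -> \bar R) : set V :=
  [set x | forall e : R, 0 < e -> (0 < m (eball x e))%E].

(** admissible action density; phi is only meaningful on (0,oo) x R^d *)
Definition admissible (p : R) (phi : R -> V -> R) : Prop :=
  (forall rho w, 0 < rho -> 0 <= phi rho w) /\
  (forall rho1 rho2 w1 w2 (t : R), 0 < rho1 -> 0 < rho2 -> 0 <= t <= 1 ->
     phi (t * rho1 + (1 - t) * rho2) (t *: w1 + (1 - t) *: w2)
       <= t * phi rho1 w1 + (1 - t) * phi rho2 w2) /\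
  (forall rho (l : R) w, 0 < rho -> phi rho (l *: w) = `|l| `^ p * phi rho w) /\
  (exists rho0, 0 < rho0 /\ forall w, w != 0 -> 0 < phi rho0 w).

Definition phi_ext (phi : R -> V -> R) (rho : R) (w : V) : \bar R :=
  if 0 < rho then (phi rho w)%:E
  else lim ((fun r => (phi r w)%:E) @ 0^'+).

Definition phi_rec (phi : R -> V -> R) (rho : R) (w : V) : \bar R :=
  lim ((fun l : R => ((l^-1)%:E * phi_ext phi (l * rho) (l *: w))%E) @ +oo).

(** (rho, w, rhop, wp, sigma) realize the Lebesgue decompositions
    mu = rho gamma + rhop sigma, nu = w gamma + wp sigma with the
    parts rhop sigma, wp sigma singular w.r.t. gamma *)
Definition lebdec (gamma : meas) (mu : meas) (nu : vmeas)
    (rho : V -> R) (w : V -> V) (rhop : V -> R) (wp : V -> V) (sigma : meas) :=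
  locfin sigma /\
  measurable_fun [set: Rd] (rho : Rd -> R) /\ (forall x, 0 <= rho x) /\
  measurable_fun [set: Rd] (rhop : Rd -> R) /\ (forall x, 0 <= rhop x) /\
  (forall i, measurable_fun [set: Rd] (fun x : Rd => w x ord0 i)) /\
  (forall i, measurable_fun [set: Rd] (fun x : Rd => wp x ord0 i)) /\
  (forall r : R, (\int[gamma]_(x in eball 0 r) (enorm (w x))%:E < +oo)%E) /\
  (forall r : R, (\int[sigma]_(x in eball 0 r) (enorm (wp x))%:E < +oo)%E) /\
  (forall A : set Rd, measurable A ->
     mu A = (\int[gamma]_(x in A) (rho x)%:E + \int[sigma]_(x in A) (rhop x)%:E)%E) /\
  (forall f, Ccv f ->
     vint nu f = Rintegral gamma [set: Rd] (fun x : Rd => dotv (w x) (f x))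
               + Rintegral sigma [set: Rd] (fun x : Rd => dotv (wp x) (f x))) /\
  (exists N : set Rd, measurable N /\ gamma N = 0%E /\
     (\int[sigma]_(x in ~` N) (rhop x + enorm (wp x))%:E = 0)%E).

Definition Phi (phi : R -> V -> R) (gamma mu : meas) (nu : vmeas) : \bar R :=
  if `[< supp mu `<=` supp gamma /\ supp (tv nu) `<=` supp gamma >] then
    ereal_inf [set v | exists rho w rhop wp sigma,
      lebdec gamma mu nu rho w rhop wp sigma /\
      v = (\int[gamma]_(x in [set: Rd]) phi_ext phi (rho x) (w x)
           + \int[sigma]_(x in [set: Rd]) phi_rec phi (rhop x) (wp x))%E]
  else +oo%E.

Definition CE (T : R) (mu : R -> meas) (nu : R -> vmeas) : Prop :=
  (forall t, 0 <= t <= T -> locfin (mu t)) /\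
  (forall f, Cc f ->
     {within `[0, T], continuous (fun t => Rintegral (mu t) [set: Rd] f)}) /\
  (forall f, Ccv f -> measurable_fun `]0, T[ (fun t => vint (nu t) f)) /\
  (forall r : R,
     (\int[lebesgue_measure]_(t in oitv T) tv (nu t) (eball 0 r) < +oo)%E) /\
  (forall z, C1c_st T z ->
     Rintegral lebesgue_measure `]0, T[
       (fun t => Rintegral (mu t) [set: Rd] (fun x : Rd => derive (z x) t 1))
     + Rintegral lebesgue_measure `]0, T[
       (fun t => vint (nu t) (fun x => grad (fun y => z y t) x)) = 0).

Definition CE_ends (T : R) (mu : R -> meas) (nu : R -> vmeas) (s e : meas) :=
  CE T mu nu /\ (forall A, measurable A -> mu 0 A = s A) /\
  (forall A, measurable A -> mu T A = e A).

Definition Wdist (p : R) (phi : R -> V -> R) (gamma mu0 mu1 : meas) : \bar R :=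
  ((ereal_inf [set v | exists (mu : R -> meas) (nu : R -> vmeas),
      CE_ends 1 mu nu mu0 mu1 /\
      v = \int[lebesgue_measure]_(t in oitv 1) Phi phi gamma (mu t) (nu t)])
   `^ (p^-1))%E.

Definition dualnorm (q : R) (gamma mu0 mu1 : meas) : \bar R :=
  ereal_sup [set ((Rintegral mu0 [set: Rd] (zeta : Rd -> R)
                   - Rintegral mu1 [set: Rd] (zeta : Rd -> R))%:E) | zeta in
    [set zeta | C1c zeta /\
       (\int[gamma]_(x in [set: Rd]) ((enorm (grad zeta x)) `^ q)%:E <= 1)%E]].

End Defs.

(* Main.v *)
Require Import Defs.
From HB Require Import structures.
From mathcomp Require Import all_boot all_order all_algebra.
From mathcomp Require Import all_classical all_reals all_analysis.
From mathcomp Require Import measurable_realfun ring lra.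

Import Order.TTheory GRing.Theory Num.Theory.
Import numFieldNormedType.Exports.

Local Open Scope classical_set_scope.
Local Open Scope ring_scope.

(** With [q = p / (p - 1)], the dual norm bounds the functional
    [zeta |-> \int zeta d(mu1 - mu0)] on gradients in [L^q(gamma)], so the functional
    is represented by a field [w] in [L^p(gamma)]: if [u] is the limit of a maximizing
    sequence of [zeta |-> \int zeta d(mu1 - mu0) - \int |grad zeta|^q dgamma] (up to
    normalization; uniform convexity makes the gradients converge strongly), the
    Euler-Lagrange equation gives [w = q |u|^(q-2) u]. The linear interpolation of
    [mu0] and [mu1] with the constant flux [w gamma] solves the continuity equation,
    its densities stay above [L], and [phi rho w <= C |w|^p] for [rho >= L]. *)

(** * The function [|x|^q] *)

(** The limit [u] need not be the gradient of a test function, so the energy is not varied at [u]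
    itself. The variation is made at the almost maximizers: the [k]-th one is moved by [2^-k] times
    a test gradient. As its energy defect is at most [4^-k], an error [2^-k] is left after division
    by the step, and dominated convergence carries the inequality over to [u]. A direction and its
    opposite together give equality. The energy is the sum of the [|u_i|^q] over the components, not
    a power of the Euclidean norm, so that tangent bounds and uniform convexity are inequalities on
    the real line. Comparing the two norms costs the factor [d + 1] in the final constant. *)

Section power.
Context {R : realType}.
Implicit Types (x y z q r : R).

(* [sign x * |x| ^ r], in a form whose continuity at [0] is immediate. *)
Definition sgpow r x : R := `|(`|x| + x) / 2| `^ r - `|(`|x| - x) / 2| `^ r.

Lemma sgpow_ge0 r x : 0 < r -> 0 <= x -> sgpow r x = x `^ r.
Proof.
move=> r0 x0; rewrite /sgpow (ger0_norm x0) subrr mul0r normr0 powR0 ?gt_eqF// subr0.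
by rewrite (_ : (x + x) / 2 = x) ?ger0_norm//; field.
Qed.

Lemma sgpow_le0 r x : 0 < r -> x <= 0 -> sgpow r x = - (`|x| `^ r).
Proof.
move=> r0 x0; rewrite /sgpow (ler0_norm x0) addNr mul0r normr0 powR0 ?gt_eqF// sub0r.
by rewrite (_ : (- x - x) / 2 = - x) ?normrN ?(ler0_norm x0)//; field.
Qed.

Lemma norm_sgpow r x : 0 < r -> `|sgpow r x| = `|x| `^ r.
Proof.
move=> r0; have [x0|/ltW x0] := leP 0 x.
  by rewrite sgpow_ge0// !ger0_norm// powR_ge0.
by rewrite sgpow_le0// normrN ger0_norm// powR_ge0.
Qed.

Lemma sgpowM r x : 0 < r -> sgpow r x * x = `|x| `^ (r + 1).
Proof.
move=> r0; have [x0|/ltW x0] := leP 0 x.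
  rewrite sgpow_ge0// ger0_norm// mulrC -[in LHS](addrK 1 r) mulr_powRB1//.
  by rewrite ltr_wpDr.
rewrite sgpow_le0// mulNr -mulrN -(ler0_norm x0) mulrC -[in LHS](addrK 1 r).
by rewrite mulr_powRB1// ltr_wpDr.
Qed.

Lemma cvg_norm_powR r : 0 < r -> continuous (fun x => `|x| `^ r).
Proof.
move=> r0 a; have [->|a0] := eqVneq a 0.
  apply/cvgrPdist_lt => e e0; rewrite normr0 powR0 ?gt_eqF//.
  have d0 : 0 < e `^ r^-1 by rewrite powR_gt0.
  near=> x; rewrite sub0r normrN ger0_norm ?powR_ge0//.
  have eE : e = (e `^ r^-1) `^ r.
    by rewrite -powRrM mulVf ?gt_eqF// powRr1// ltW.
  rewrite [ltRHS]eE gt0_ltr_powR ?nnegrE ?powR_ge0 ?normr_ge0//.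
apply: (@continuous_comp _ _ _ (fun x : R => `|x|) (fun x => x `^ r)).
  exact: norm_continuous.
apply: differentiable_continuous; apply/derivable1_diffP.
by apply: derivable_powR; rewrite in_itv/= andbT normr_gt0.
Unshelve. all: by end_near. Qed.

Lemma cvg_sgpow r : 0 < r -> continuous (sgpow r).
Proof.
move=> r0 a; apply: cvgB.
  apply: (@continuous_comp _ _ _ (fun x : R => (`|x| + x) / 2) (fun x => `|x| `^ r)).
    by apply: cvgM; [apply: cvgD; [exact: norm_continuous|exact: cvg_id]|exact: cvg_cst].
  exact: cvg_norm_powR.
apply: (@continuous_comp _ _ _ (fun x : R => (`|x| - x) / 2) (fun x => `|x| `^ r)).
  by apply: cvgM; [apply: cvgB; [exact: norm_continuous|exact: cvg_id]|exact: cvg_cst].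
exact: cvg_norm_powR.
Qed.

(** Convexity of [|.|^q]: Young's inequality with exponents [q / (q - 1)] and [q] bounds
    [sgpow (q - 1) y * z]. *)
Lemma norm_powR_tangent q y z : 1 < q ->
  `|y| `^ q + q * sgpow (q - 1) y * (z - y) <= `|z| `^ q.
Proof.
move=> q1; have q0 : 0 < q by lra.
have q10 : 0 < q - 1 by lra.
have Hy : sgpow (q - 1) y * y = `|y| `^ q by rewrite sgpowM// subrK.
have Hz : sgpow (q - 1) y * z <= `|y| `^ (q - 1) * `|z|.
  by rewrite -(norm_sgpow _ y)// -normrM ler_norm.
have := @conjugate_powR R (`|y| `^ (q - 1)) `|z| (q / (q - 1)) q
  (powR_ge0 _ _) (normr_ge0 _) (divr_gt0 q0 q10) q0.
have -> : (q / (q - 1))^-1 + q^-1 = 1 by field; rewrite !gt_eqF.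
move=> /(_ erefl); rewrite -powRrM.
have -> : (q - 1) * (q / (q - 1)) = q by field; rewrite gt_eqF.
set A := `|y| `^ q in Hy *; set B := `|z| `^ q; move=> H.
have {}H : q * (sgpow (q - 1) y * z) <= (q - 1) * A + B.
  apply: (@le_trans _ _ (q * (A / (q / (q - 1)) + B / q))).
    by rewrite ler_pM2l// (le_trans Hz).
  rewrite le_eqVlt; apply/orP; left; apply/eqP; by field; rewrite !gt_eqF.
rewrite mulrBr -!mulrA Hy; lra.
Qed.

(** For [x > 0], [1 + t < expR t] is used twice: at [(q - 1) * ln x] it gives
    [x^q > x + (q - 1) x ln x], and at [- ln x] it gives [x ln x > x - 1]. *)
Lemma powR_gt_tangent q x : 1 < q -> 0 <= x -> x != 1 -> 1 + q * (x - 1) < x `^ q.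
Proof.
move=> q1; rewrite le_eqVlt => /predU1P[<- _|x0 x1].
  by rewrite powR0 ?gt_eqF//; lra.
have lnx0 : ln x != 0 by rewrite ln_eq0.
have E1 : x `^ q = x * expR ((q - 1) * ln x).
  rewrite -mulr_powRB1 ?ltW//; last lra.
  by rewrite /powR gt_eqF.
have E2 : x * expR (- ln x) = 1.
  by rewrite expRN lnK ?posrE// mulfV ?gt_eqF.
have F1 : 1 + (q - 1) * ln x < expR ((q - 1) * ln x).
  by apply: expR_gt1Dx; rewrite mulf_neq0// gt_eqF; lra.
have F2 : 1 - ln x < expR (- ln x) by apply: expR_gt1Dx; rewrite oppr_eq0.
have F3 : x * (q - 1) * (1 - ln x) < x * (q - 1) * expR (- ln x).
  by rewrite ltr_pM2l// mulr_gt0//; lra.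
have F4 : x * (1 + (q - 1) * ln x) < x * expR ((q - 1) * ln x) by rewrite ltr_pM2l.
have F5 : x * (q - 1) * expR (- ln x) = q - 1 by rewrite mulrAC E2 mul1r.
rewrite E1; move: F3; rewrite F5; move: F4.
set E := x * expR _; nra.
Qed.

(** With [m = (1 + b) / 2], the numbers [1 / m] and [b / m] add up to 2, so their tangent bounds at
    1 add up to 2, strictly because [1 / m != 1]; multiplying by [m^q] concludes. The value
    [b = -1], where [m = 0], is separate. *)
Lemma norm_powR_midpoint q b : 1 < q -> -1 <= b <= 1 -> b != 1 ->
  `|(1 + b) / 2| `^ q < (1 + `|b| `^ q) / 2.
Proof.
move=> q1 /andP[bN1 b1] bn1.
have m0 : 0 <= (1 + b) / 2 by lra.
have [->|bn] := eqVneq b (-1).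
  by rewrite subrr mul0r normr0 powR0 ?gt_eqF ?normrN1 ?powR1; lra.
have {}m0 : 0 < (1 + b) / 2 by move: bn; rewrite neq_lt; lra.
set m := (1 + b) / 2 in m0 *.
have mn : m^-1 != 1 by rewrite invr_eq1 /m; move: bn1; rewrite !neq_lt; lra.
have H1 := @powR_gt_tangent q m^-1 q1 _ mn.
have H2 := @norm_powR_tangent q 1 (b / m) q1.
move: H2; rewrite sgpow_ge0 ?subr_gt0// normr1 !powR1 mulr1 normrM.
rewrite (gtr0_norm (_ : 0 < m^-1)) ?invr_gt0//.
rewrite powRM ?normr_ge0 ?invr_ge0 ?(ltW m0)// => H2.
have {}H1 : 1 + q * (m^-1 - 1) < m^-1 `^ q by apply: H1; rewrite invr_ge0 ltW.
have sum2 : m^-1 + b / m = 2 by rewrite /m; field; rewrite gt_eqF; move: m0; rewrite /m; lra.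
have H3 : 2 < m^-1 `^ q * (1 + `|b| `^ q) by nra.
rewrite gtr0_norm//.
have := H3; rewrite -(ltr_pM2l (_ : 0 < m `^ q)) ?powR_gt0// mulrA -powRM ?invr_ge0 ?ltW//.
rewrite mulfV ?gt_eqF// powR1; lra.
Qed.

Lemma norm_powR_midpoint_le q x y : 1 < q ->
  `|(x + y) / 2| `^ q <= (`|x| `^ q + `|y| `^ q) / 2.
Proof.
move=> q1; have Hx := @norm_powR_tangent q ((x + y) / 2) x q1.
have Hy := @norm_powR_tangent q ((x + y) / 2) y q1.
set s := q * sgpow _ _ in Hx Hy; nra.
Qed.

(** Uniform convexity by compactness of [[-1, 1]]: the midpoint gap vanishes only at [b = 1], where
    the left side is small. Allowing the error [e] treats all [q > 1] at once, with no split at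
    [q = 2]. *)
Lemma norm_powR_uconvex_unit q e : 1 < q -> 0 < e -> exists C, 0 <= C /\
  forall b, -1 <= b <= 1 ->
  `|1 - b| `^ q <= e + C * ((1 + `|b| `^ q) / 2 - `|(1 + b) / 2| `^ q).
Proof.
move=> q1 e0; pose D b := (1 + `|b| `^ q) / 2 - `|(1 + b) / 2| `^ q.
pose P (y : R) := (`|y| + y) / 2.
have P0 y : 0 <= P y by rewrite /P; have := ler_norm (- y); rewrite normrN; lra.
(* [P] is the positive part. [F] is positive on [[-1, 1]]: at 1 its second term is [e], elsewhere
   the gap [D] is positive. Where [|1 - b|^q > e] the second term is zero, so the minimum of [F]
   bounds [D] from below. *)
pose F b := D b + P (e - `|1 - b| `^ q).
have q0 : 0 < q by lra.
have cP := cvg_norm_powR _ q0.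
have Dge0 b : 0 <= D b.
  have := norm_powR_midpoint_le q 1 b q1.
  by rewrite normr1 powR1 /D; lra.
have cF : continuous F.
  move=> b; apply: cvgD.
    apply: cvgB.
      by apply: cvgM; [apply: cvgD; [exact: cvg_cst|exact: cP]|exact: cvg_cst].
    apply: (@continuous_comp _ _ _ (fun x : R => (1 + x) / 2) (fun x => `|x| `^ q)); last exact: cP.
    by apply: cvgM; [apply: cvgD; [exact: cvg_cst|exact: cvg_id]|exact: cvg_cst].
  apply: (@continuous_comp _ _ _ (fun b : R => e - `|1 - b| `^ q) P); last first.
    by apply: cvgM; [apply: cvgD; [exact: norm_continuous|exact: cvg_id]|exact: cvg_cst].
  apply: cvgB; first exact: cvg_cst.
  apply: (@continuous_comp _ _ _ (fun x : R => 1 - x) (fun x => `|x| `^ q)); last exact: cP.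
  by apply: cvgB; [exact: cvg_cst|exact: cvg_id].
have [|c cI cmin] := @EVT_min R F (-1) 1 _ (@continuous_subspaceT _ _ _ F cF).
  by lra.
have Fc : 0 < F c.
  have := Dge0 c; rewrite /F; have [->|c1] := eqVneq c 1 => D0.
    by rewrite subrr normr0 powR0 ?gt_eqF// subr0 ltr_wpDl// /P gtr0_norm//; lra.
  apply: ltr_wpDr; first exact: P0.
  by rewrite /D subr_gt0 norm_powR_midpoint.
exists (2 `^ q / F c); split; first by rewrite divr_ge0 ?powR_ge0// ltW.
move=> b bI; rewrite -/(D b).
have [be|be] := leP (`|1 - b| `^ q) e.
  by apply: (le_trans be); rewrite lerDl mulr_ge0// divr_ge0 ?powR_ge0// ltW.
have DF : F c <= D b.
  have := cmin b; rewrite /F in_itv/= => /(_ bI).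
  rewrite (_ : P (e - `|1 - b| `^ q) = 0) ?addr0; last first.
    by rewrite /P ltr0_norm; lra.
  by [].
apply: (@le_trans _ _ (2 `^ q)).
  apply: ge0_ler_powR; rewrite ?nnegrE ?normr_ge0//; first lra.
  by rewrite ler_norml; lra.
apply: (@le_trans _ _ (2 `^ q / F c * F c)).
  by rewrite divfK// gt_eqF.
apply: ler_wpDl; first exact: ltW.
by rewrite ler_wpM2l// divr_ge0 ?powR_ge0// ltW.
Qed.

(** By symmetry [|y| <= |x|]; then [y = x * b] with [b] in [[-1, 1]], and the unit case scales by
    [|x|^q]. *)
Lemma norm_powR_uconvex q e : 1 < q -> 0 < e -> exists C, 0 <= C /\
  forall x y, `|x - y| `^ q + C * `|(x + y) / 2| `^ q <=
    e * (`|x| `^ q + `|y| `^ q) + C * ((`|x| `^ q + `|y| `^ q) / 2).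
Proof.
move=> q1 e0; have [C [C0 HC]] := @norm_powR_uconvex_unit q e q1 e0.
exists C; split => // x y.
wlog xy : x y / `|y| <= `|x|.
  move=> H; have [|/ltW xy] := leP `|y| `|x|; first exact: H.
  by have := H y x xy; rewrite distrC (addrC y) (addrC (`|y| `^ q)).
have [x0|x0] := eqVneq x 0.
  move: xy; rewrite x0 normr0 normr_le0 => /eqP ->.
  by rewrite !(subr0, addr0, mul0r, normr0) powR0 ?gt_eqF ?mulr0 ?addr0; lra.
have q0 : 0 < q by lra.
have [b bI ->] : exists2 b, -1 <= b <= 1 & y = x * b.
  exists (y / x); last by rewrite mulrC divfK.
  by rewrite -ler_norml normrM normfV ler_pdivrMr ?normr_gt0// mul1r.
have X0 : 0 < `|x| `^ q by rewrite powR_gt0// normr_gt0.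
have := HC b bI.
have -> : x - x * b = x * (1 - b) by ring.
have -> : (x + x * b) / 2 = x * ((1 + b) / 2) by field.
rewrite !(normrM x) !(powRM _ (normr_ge0 x))//.
rewrite -[in X in X -> _](ler_pM2l X0).
have := powR_ge0 `|b| q.
set X := `|x| `^ q in X0 *; set Y := `|b| `^ q; set Z := `|1 - b| `^ q.
set W := `|(1 + b) / 2| `^ q => Y0 H.
have H1 : 0 <= e * (X * Y) by rewrite !mulr_ge0// ltW.
have -> : e * (X + X * Y) + C * ((X + X * Y) / 2) =
  X * (e + C * ((1 + Y) / 2 - W)) + e * (X * Y) + C * (X * W) by field.
by rewrite lerD2r (le_trans H)// lerDl.
Qed.

End power.

(** * Duality in [L^q] *)

Section real_sequence.
Context {R : realType}.

Lemma geometric_increment_bound (a : nat -> R) (h : R) : 0 <= h ->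
  (forall k, `|a k.+1 - a k| <= h * 2^-1 ^+ k) ->
  forall k, `|a k| <= `|a 0%N| + 2 * h.
Proof.
move=> h0 ha; suff H k : `|a k| <= `|a 0%N| + 2 * h * (1 - 2^-1 ^+ k).
  move=> k; apply: (le_trans (H k)).
  have : 0 <= (2^-1 : R) ^+ k by rewrite exprn_ge0.
  set t := _ ^+ k; nra.
elim: k => [|k IH]; first by rewrite expr0 subrr mulr0 addr0.
have := ha k; have := ler_normD (a k.+1 - a k) (a k); rewrite subrK exprS.
move: IH; set t := _ ^+ k; lra.
Qed.

Lemma geometric_increment_cvg (a : nat -> R) (h : R) : 0 <= h ->
  (forall k, `|a k.+1 - a k| <= h * 2^-1 ^+ k) -> cvgn a.
Proof.
move=> h0 ha; have c1 : cvgn (series (telescope a)).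
  apply: (@normed_cvg R R^o); apply: (@series_le_cvg _ _ (geometric h 2^-1)).
  - by move=> n /=; exact: normr_ge0.
  - by move=> n; rewrite /geometric/= mulr_ge0// exprn_ge0.
  - by move=> n; exact: ha.
  - by apply: is_cvg_geometric_series; rewrite ger0_norm// invf_lt1// ltr1n.
have -> : a = (fun n => series (telescope a) n + a 0%N).
  by rewrite telescopeK; apply/funext => n; rewrite subrK.
by apply: is_cvgD => //; exact: is_cvg_cst.
Qed.

End real_sequence.

(** * The componentwise [q]-energy *)

Section powsum.
Context {R : realType} {dX : measure_display} {X : measurableType dX}
  {d : nat} (gamma : {measure set X -> \bar R}).
Implicit Types (u v : 'I_d -> X -> R) (q : R).

Definition powsum q u (x : X) : R := \sum_(i < d) `|u i x| `^ q.

Lemma powsum_ge0 q u x : 0 <= powsum q u x.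
Proof. by apply: sumr_ge0 => i _; exact: powR_ge0. Qed.

Lemma measurable_powsum q u : (forall i, measurable_fun setT (u i)) ->
  measurable_fun setT (powsum q u).
Proof.
move=> mu; apply: measurable_sum => i.
apply: (@measurableT_comp _ _ _ _ _ _ (fun x : R => x `^ q)).
  exact: measurable_powR.
exact: measurableT_comp.
Qed.

Definition inLq q u := (forall i, measurable_fun setT (u i)) /\
  gamma.-integrable setT (EFin \o powsum q u).

Definition Nq q u : R := \int[gamma]_x powsum q u x.

Lemma Nq_ge0 q u : 0 <= Nq q u.
Proof. by apply: Rintegral_ge0 => x _; exact: powsum_ge0. Qed.

Lemma EFin_Nq q u : inLq q u -> ((Nq q u)%:E = \int[gamma]_x (powsum q u x)%:E)%E.
Proof. by move=> [_ iu]; rewrite /Nq /Rintegral fineK// integrable_fin_num. Qed.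

Lemma powsumZ q k u x : powsum q (fun i x => k * u i x) x = `|k| `^ q * powsum q u x.
Proof.
rewrite /powsum mulr_sumr; apply: eq_bigr => i _.
by rewrite normrM powRM.
Qed.

Lemma NqZ q k u : inLq q u -> Nq q (fun i x => k * u i x) = `|k| `^ q * Nq q u.
Proof.
move=> [_ iu]; rewrite /Nq -RintegralZl//.
by apply: eq_Rintegral => x _; rewrite powsumZ.
Qed.

(** Difference and midpoint are written as [k * u + l * v] to match literally the closure of the
    graph [K] under linear combinations. *)
Lemma Nq_uconvex q e : 1 < q -> 0 < e -> exists C, 0 <= C /\ forall u v,
  inLq q u -> inLq q v -> inLq q (fun i x => 1 * u i x + (-1) * v i x) ->
  inLq q (fun i x => 2^-1 * u i x + 2^-1 * v i x) ->
  Nq q (fun i x => 1 * u i x + (-1) * v i x) +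
    C * Nq q (fun i x => 2^-1 * u i x + 2^-1 * v i x) <=
  e * (Nq q u + Nq q v) + C * ((Nq q u + Nq q v) / 2).
Proof.
move=> q1 e0; have [C [C0 HC]] := @norm_powR_uconvex R q e q1 e0.
exists C; split => // u v [mu iu] [mv iv] [md id] [mm im].
set D := (fun i x => 1 * u i x + _) in id *; set M := (fun i x => 2^-1 * u i x + _) in im *.
have iuv : gamma.-integrable setT (EFin \o (fun x => powsum q u x + powsum q v x)).
  by rewrite (_ : _ \o _ = (EFin \o powsum q u) \+ (EFin \o powsum q v))//; exact: integrableD.
have iM : gamma.-integrable setT (EFin \o (fun x => C * powsum q M x)).
  exact: (integrableZl measurableT C im).
have -> : e * (Nq q u + Nq q v) + C * ((Nq q u + Nq q v) / 2) =
  (e + C / 2) * (Nq q u + Nq q v).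
  by move: (Nq q u) (Nq q v) => a b; field.
rewrite -[Nq q u + _](RintegralD measurableT iu iv).
rewrite -(RintegralZl _ measurableT iuv) -(RintegralZl _ measurableT im).
rewrite -(RintegralD measurableT id iM).
apply: le_Rintegral => //.
- by rewrite (_ : _ \o _ = (EFin \o powsum q D) \+
    (EFin \o (fun x => C * powsum q M x)))//; exact: integrableD.
- exact: (integrableZl measurableT (e + C / 2) iuv).
move=> x _; rewrite /powsum -big_split/= !mulr_sumr -!big_split/=.
apply: ler_sum => i _; have := HC (u i x) (v i x).
rewrite /D /M mul1r mulN1r -mulrDr [2^-1 * _]mulrC.
set A := `|u i x| `^ q; set B := `|v i x| `^ q; lra.
Qed.

End powsum.

Section uconvex_arith.
Context {R : realFieldType}.

(** Here [x], [y], [D], [m] stand for the energies of [u], [v], their difference and their midpoint,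
    [a], [b] for the values of the functional, and [S] for the supremum. Averaging the two
    almost-maximality bounds against the bound at the midpoint gives [(x + y) / 2 <= m + e]. *)
Lemma uconvex_arith (x y D m C e h M S a b : R) :
  D + C * m <= h / (4 * M) * (x + y) + C * ((x + y) / 2) ->
  x <= M -> y <= M -> 0 < M -> 0 < h -> 0 <= C -> C * e <= h / 2 ->
  S - e <= a - x -> S - e <= b - y -> 2^-1 * a + 2^-1 * b - m <= S -> D <= h.
Proof.
move=> H xM yM M0 h0 C0 Ce ax byy ab.
have e0 : 0 <= h / (4 * M) by rewrite divr_ge0 ?mulr_ge0// ltW.
have H1 : h / (4 * M) * (x + y) <= h / 2.
  apply: (@le_trans _ _ (h / (4 * M) * (M + M))).
    by rewrite ler_wpM2l// lerD.
  by rewrite le_eqVlt; apply/orP; left; apply/eqP; field; rewrite gt_eqF.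
have H2 : C * ((x + y) / 2) <= C * (m + e) by rewrite ler_wpM2l//; lra.
rewrite mulrDr in H2; lra.
Qed.

End uconvex_arith.

(** * Almost maximizers of a linear functional minus the energy *)

Section maximization.
Context {R : realType} {dX : measure_display} {X : measurableType dX}
  {d : nat} (gamma : {measure set X -> \bar R}) (q : R) (q1 : 1 < q).
Context (K : ('I_d -> X -> R) -> R -> Prop).
Context (K0 : K (fun _ _ => 0) 0).
Context (Klin : forall k l u a v b, K u a -> K v b ->
  K (fun i x => k * u i x + l * v i x) (k * a + l * b)).
Context (KL : forall u a, K u a -> inLq gamma q u).
Context (Kle1 : forall u a, K u a -> Nq gamma q u <= 1 -> a <= 1).

Local Notation N := (Nq gamma q).

(** When [N u > 1], scaling [u] to unit energy gives [a <= t] with [t = N(u)^(1/q)], and the tangent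
    to [t^q] at 1 bounds [t] by [1 + t^q / q]. *)
Lemma functional_coercive u a : K u a -> a <= 1 + N u / q.
Proof.
move=> Ku; have hq1 := q1; have q0 : 0 < q by lra.
have N0 := Nq_ge0 gamma q u.
have [N1|N1] := leP (N u) 1.
  by rewrite (le_trans (Kle1 _ _ Ku N1))// lerDl divr_ge0// ltW.
have N0' : 0 < N u by lra.
pose t := N u `^ q^-1.
have t0 : 0 < t by rewrite powR_gt0.
have tq : t `^ q = N u by rewrite -powRrM mulVf ?gt_eqF// powRr1.
have Kt := Klin t^-1 0 _ _ _ _ Ku K0.
have := Kle1 _ _ Kt.
have -> : (fun i x => t^-1 * u i x + 0 * 0) = (fun i x => t^-1 * u i x).
  by apply/funext => i; apply/funext => x; rewrite mulr0 addr0.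
rewrite NqZ; last exact: KL Ku.
rewrite mulr0 addr0 gtr0_norm ?invr_gt0// -tq -powRM ?invr_ge0 ?(ltW t0)//.
rewrite mulVf ?gt_eqF// powR1 => /(_ (lexx _)).
rewrite mulrC ler_pdivrMr// mul1r => /le_trans; apply.
have := norm_powR_tangent q 1 t q1.
rewrite sgpow_ge0//; last lra.
rewrite normr1 !powR1 mulr1 (gtr0_norm t0) => H.
have tE : t = (1 + q * (t - 1) + (q - 1)) / q by field; rewrite gt_eqF.
rewrite [leLHS]tE.
have -> : 1 + t `^ q / q = (t `^ q + q) / q by field; rewrite gt_eqF.
by rewrite ler_pM2r ?invr_gt0//; lra.
Qed.

Let q0 : 0 < q. Proof. by rewrite (lt_trans _ q1). Qed.

Definition energy_values := [set j : R | exists u a, K u a /\ j = a - N u].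
Definition energy_sup := sup energy_values.

Lemma energy_has_sup : has_sup energy_values.
Proof.
split; first by exists (0 - N (fun (_ : 'I_d) _ => 0)), (fun _ _ => 0), 0.
exists 1 => _ [u [a [Ku ->]]]; have := functional_coercive u a Ku.
have := Nq_ge0 gamma q u => N0 H.
have : N u / q <= N u by rewrite ler_pdivrMr// ler_peMr// ltW.
by lra.
Qed.

Lemma le_energy_sup u a : K u a -> a - N u <= energy_sup.
Proof.
move=> Ku; apply: (sup_upper_bound energy_has_sup); by exists u, a.
Qed.

Lemma energy_sup_ge0 : 0 <= energy_sup.
Proof.
have := le_energy_sup _ _ K0; congr (_ <= _).
rewrite sub0r /Nq (_ : (fun x => _) = cst 0) ?Rintegral_cst ?mul0r ?oppr0//.
apply/funext => x; rewrite /powsum big1// => i _.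
by rewrite normr0 powR0// gt_eqF.
Qed.

Let M := 2 * q / (q - 1).

(** Since the supremum is nonnegative, [-1 <= a - N u]; coercivity then gives
    [N u * ((q - 1) / q) <= 2]. This [M] enters the final constant. *)
Lemma almost_maximizer_bound u a : K u a -> energy_sup - 1 <= a - N u -> N u <= M.
Proof.
have hq1 := q1; move=> Ku H; have := functional_coercive u a Ku; have := energy_sup_ge0 => S0 Hc.
have : N u - N u / q <= 2 by lra.
have -> : N u - N u / q = N u * ((q - 1) / q) by field; rewrite gt_eqF.
rewrite -ler_pdivlMr; last by rewrite divr_gt0//; lra.
by rewrite /M invf_div mulrA.
Qed.

Lemma almost_maximizers_close h : 0 < h -> exists e, 0 < e /\ forall u a v b,
  K u a -> K v b -> energy_sup - e <= a - N u -> energy_sup - e <= b - N v ->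
  N (fun i x => 1 * u i x + (-1) * v i x) <= h.
Proof.
have hq1 := q1; move=> h0; have M0 : 0 < M by rewrite /M divr_gt0// ?mulr_gt0//; lra.
have e0 : 0 < h / (4 * M) by rewrite divr_gt0// mulr_gt0.
have [C [C0 HC]] := @Nq_uconvex R dX X d gamma q _ q1 e0.
have C1 : 0 < C + 1 by lra.
(* The [1] puts both energies below [M]; [C + 1] keeps the denominator positive when [C = 0]. *)
exists (Num.min 1 (h / (2 * (C + 1)))); split.
  by rewrite lt_min ltr01 divr_gt0// mulr_gt0.
set e := Num.min _ _ => u a v b Ku Kv Hu Hv.
have e1 : e <= 1 by rewrite ge_min lexx.
have eC : C * e <= h / 2.
  apply: (@le_trans _ _ ((C + 1) * (h / (2 * (C + 1))))).
    apply: ler_pM => //; last by rewrite ge_min lexx orbT.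
      by rewrite le_min ler01 divr_ge0 ?mulr_ge0// ltW.
    by rewrite lerDl.
  by rewrite le_eqVlt; apply/orP; left; apply/eqP; field; rewrite gt_eqF.
have Se x y : energy_sup - e <= x - y -> energy_sup - 1 <= x - y.
  by apply: le_trans; rewrite lerD2l lerN2.
have Nu := almost_maximizer_bound _ _ Ku (Se _ _ Hu).
have Nv := almost_maximizer_bound _ _ Kv (Se _ _ Hv).
have Km := Klin 2^-1 2^-1 _ _ _ _ Ku Kv.
have Kd := Klin 1 (-1) _ _ _ _ Ku Kv.
have H := HC u v (KL _ _ Ku) (KL _ _ Kv) (KL _ _ Kd) (KL _ _ Km).
exact: (uconvex_arith _ _ _ _ _ _ _ _ _ _ _ H Nu Nv M0 h0 C0 eC Hu Hv (le_energy_sup _ _ Km)).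
Qed.

Lemma maximizing_sequence (eta : nat -> R) : (forall k, 0 < eta k) ->
  exists (e : nat -> R) (u : nat -> 'I_d -> X -> R) (a : nat -> R), [/\
    forall k, K (u k) (a k),
    forall k, N (u k) <= M,
    forall k, 0 < e k <= 4^-1 ^+ k,
    forall k, energy_sup - e k <= a k - N (u k) &
    forall k, N (fun i x => 1 * u k.+1 i x + (-1) * u k i x) <= eta k].
Proof.
move=> eta0.
have [e0 He0] := choice (fun k => almost_maximizers_close _ (eta0 k)).
(* Division by 4 gives the decay [4^-k] and makes [e] decreasing, so that [u k.+1] as well as [u k]
   meets the threshold [e0 k]. *)
pose e := fix e k := if k is k'.+1 then Num.min (e k' / 4) (e0 k'.+1)
  else Num.min 1 (e0 0%N).
have e_gt0 k : 0 < e k.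
  elim: k => [|k IH] /=; rewrite lt_min (He0 _).1 andbT//.
  by rewrite divr_gt0.
have ee0 k : e k <= e0 k by case: k => [|k] /=; rewrite ge_min lexx orbT.
have eS k : e k.+1 <= e k / 4 by rewrite /= ge_min lexx.
have e4 k : e k <= 4^-1 ^+ k.
  elim: k => [|k IH]; first by rewrite /= expr0 ge_min lexx.
  rewrite (le_trans (eS k))// exprSr; lra.
have ex k : exists ua : ('I_d -> X -> R) * R, K ua.1 ua.2 /\
    energy_sup - e k <= ua.2 - N ua.1.
  have [_ [u [a [Ku ->]]] H] := sup_adherent (e_gt0 k) energy_has_sup.
  by exists (u, a); split => //; exact: ltW.
have [f Hf] := choice ex.
exists e, (fun k => (f k).1), (fun k => (f k).2); split => k.
- exact: (Hf k).1.
- apply: (almost_maximizer_bound _ _ (Hf k).1); have := (Hf k).2.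
  have : e k <= 1 by rewrite (le_trans (e4 k))// exprn_ile1//; lra.
  by lra.
- by rewrite e_gt0 e4.
- exact: (Hf k).2.
- apply: ((He0 k).2 _ _ _ _ (Hf k.+1).1 (Hf k).1).
  + have := (Hf k.+1).2; have := ee0 k; have := eS k; have := e_gt0 k; lra.
  + have := (Hf k).2; have := ee0 k; lra.
Qed.

End maximization.

Section power_bounds.
Context {R : realType}.
Implicit Types (a b q : R).

Lemma powRD_le q a b : 0 < q -> 0 <= a -> 0 <= b ->
  (a + b) `^ q <= 2 `^ q * (a `^ q + b `^ q).
Proof.
move=> q0 a0 b0; wlog ab : a b a0 b0 / a <= b.
  move=> H; have [|/ltW] := leP a b; first exact: H.
  by move=> ba; rewrite addrC (addrC (a `^ q)); exact: H.
apply: (@le_trans _ _ ((2 * b) `^ q)).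
  by apply: ge0_ler_powR; rewrite ?nnegrE ?addr_ge0 ?mulr_ge0 ?(ltW q0)//; lra.
by rewrite powRM// ler_wpM2l ?powR_ge0// lerDr powR_ge0.
Qed.

Lemma powR_young_le q a b : 1 < q -> 0 <= a -> 0 <= b ->
  a `^ (q - 1) * b <= a `^ q + b `^ q.
Proof.
move=> q1 a0 b0; have q0 : 0 < q by lra.
have [ba|/ltW ab] := leP b a.
  apply: (@le_trans _ _ (a `^ q)); last by rewrite lerDl powR_ge0.
  by rewrite -(@mulr_powRB1 _ a q)// mulrC ler_wpM2r// powR_ge0.
apply: (@le_trans _ _ (b `^ q)); last by rewrite lerDr powR_ge0.
rewrite -(@mulr_powRB1 _ b q)// mulrC ler_wpM2l//.
by apply: ge0_ler_powR; rewrite ?nnegrE//; lra.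
Qed.

End power_bounds.

Section integrable_real.
Context {R : realType} {dX : measure_display} {X : measurableType dX}
  (gamma : {measure set X -> \bar R}).
Implicit Types (f g : X -> R).

Lemma integrable_EFinD f g : gamma.-integrable setT (EFin \o f) ->
  gamma.-integrable setT (EFin \o g) ->
  gamma.-integrable setT (EFin \o (fun x => f x + g x)).
Proof. by move=> hf hg; exact: (integrableD measurableT hf hg). Qed.

Lemma integrable_EFinZ (k : R) f : gamma.-integrable setT (EFin \o f) ->
  gamma.-integrable setT (EFin \o (fun x => k * f x)).
Proof. by move=> hf; exact: (integrableZl measurableT k hf). Qed.

Lemma le_integrable_EFin f g : measurable_fun setT f ->
  (forall x, `|f x| <= g x) -> gamma.-integrable setT (EFin \o g) ->
  gamma.-integrable setT (EFin \o f).
Proof.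
move=> mf fg; apply: le_integrable => //; first exact/measurable_EFinP.
by move=> x _ /=; rewrite lee_fin (le_trans (fg x))// ler_norm.
Qed.

End integrable_real.

(** * Domination of fast Cauchy sequences in [L^q] *)

Section fast_cauchy.
Context {R : realType} {dX : measure_display} {X : measurableType dX}
  {d : nat} (gamma : {measure set X -> \bar R}) (q : R) (q0 : 0 < q).
Context (u : nat -> 'I_d -> X -> R).
Let D k : 'I_d -> X -> R := fun i x => 1 * u k.+1 i x + (-1) * u k i x.
Context (DL : forall k, inLq gamma q (D k)).
Context (DN : forall k, Nq gamma q (D k) <= (2 * 2 `^ q)^-1 ^+ k).

(* [H = \sum_k 2^(kq) |D_k|^q] is integrable, and each of its terms is at most [H]. *)
Lemma fast_cauchy_dominated : exists h : X -> R, [/\ forall x, 0 <= h x,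
  gamma.-integrable setT (EFin \o (fun x => h x `^ q)),
  measurable_fun setT h &
  {ae gamma, forall x, forall k i, `|u k.+1 i x - u k i x| <= h x * 2^-1 ^+ k}].
Proof.
pose c : R := 2 `^ q; have c0 : 0 < c by rewrite powR_gt0.
pose F k x : \bar R := (c ^+ k * powsum q (D k) x)%:E.
have F0 k x : (0 <= F k x)%E by rewrite lee_fin mulr_ge0 ?exprn_ge0 ?powsum_ge0 ?ltW.
have mF k : measurable_fun setT (F k).
  apply/measurable_EFinP; apply: measurable_funM => //.
  by apply: measurable_powsum; case: (DL k).
pose H x := (\sum_(k <oo) F k x)%E.
have H0 x : (0 <= H x)%E by apply: nneseries_ge0 => k _ _; exact: F0.
have mH : measurable_fun setT H by apply: ge0_emeasurable_sum.
have iH : gamma.-integrable setT H.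
  apply/integrableP; split => //.
  under eq_integral do rewrite gee0_abs//.
  rewrite integral_nneseries//.
  (* Each integral is at most [c^k * (2 * c)^-k = 2^-k], written as [2 / 2^(k+1)] to fit
     [epsilon_trick0]. *)
  apply: (@le_lt_trans _ _ (\sum_(k <oo) (2 / (2 ^ k.+1)%:R)%:E)%E); last first.
    by apply: (le_lt_trans (epsilon_trick0 _ _)) => //; rewrite ltry.
  apply: lee_nneseries => k _; first by move=> _; apply: integral_ge0 => x _; exact: F0.
  rewrite /F; under eq_integral do rewrite EFinM.
  rewrite ge0_integralZl//; last 3 first.
  - by apply/measurable_EFinP; apply: measurable_powsum; case: (DL k).
  - by move=> x _; rewrite lee_fin powsum_ge0.
  - by rewrite lee_fin exprn_ge0// ltW.
  rewrite -EFin_Nq// -EFinM lee_fin.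
  apply: (@le_trans _ _ (c ^+ k * (2 * c)^-1 ^+ k)).
    by rewrite ler_wpM2l// exprn_ge0// ltW.
  rewrite -exprMn invfM mulrCA mulfV ?gt_eqF// mulr1 exprVn natrX exprS invfM.
  by rewrite mulrA mulfV// mul1r.
pose h x := fine (H x) `^ q^-1.
have hq x : h x `^ q = fine (H x).
  by rewrite /h -powRrM mulVf ?gt_eqF// powRr1// fine_ge0.
exists h; split => [x|||].
- exact: powR_ge0.
- rewrite (_ : (fun x => _) = fine \o H); last by apply/funext => x; rewrite hq.
  apply: le_integrable iH => //.
    by apply/measurable_EFinP; exact: measurableT_comp.
  by move=> x _ /=; case: (H x) => [r|//|//] /=; rewrite ?leey.
- apply: (@measurableT_comp _ _ _ _ _ _ (fun x : R => x `^ q^-1)).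
    exact: measurable_powR.
  exact: measurableT_comp.
apply: filterS (integrable_ae measurableT iH) => x /(_ Logic.I) Hx k i.
have h0 : 0 <= h x by exact: powR_ge0.
have le1 : (F k x <= H x)%E.
  apply: le_trans (nneseries_lim_ge k.+1 _) => //.
  by rewrite big_nat_recr//= leeDr// sume_ge0.
have {}le1 : c ^+ k * powsum q (D k) x <= h x `^ q by rewrite hq -lee_fin fineK.
have le2 : c ^+ k * `|D k i x| `^ q <= h x `^ q.
  apply: le_trans le1; rewrite ler_wpM2l ?exprn_ge0 ?(ltW c0)//.
  by rewrite /powsum (bigD1 i)//= lerDl sumr_ge0// => j _; exact: powR_ge0.
have ck : c ^+ k = (2 ^+ k) `^ q.
  by rewrite -[in RHS]powR_mulrn// -powRrM mulrC powRrM powR_mulrn// powR_ge0.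
rewrite -[X in `|X|](_ : D k i x = _); last by rewrite /D mul1r mulN1r.
rewrite exprVn ler_pdivlMr ?exprn_gt0// mulrC leNgt; apply/negP => lt.
move: le2; rewrite ck -powRM ?exprn_ge0// leNgt => /negP; apply.
by apply: gt0_ltr_powR; rewrite ?nnegrE ?mulr_ge0 ?exprn_ge0.
Qed.

End fast_cauchy.

Lemma cvg_sumr {R : realType} {T I : Type} (F : set_system T) {FF : Filter F}
    (r : seq I) (f : I -> T -> R) (l : I -> R) :
  (forall i, f i x @[x --> F] --> l i) ->
  \sum_(i <- r) f i x @[x --> F] --> \sum_(i <- r) l i.
Proof.
move=> fl; elim: r => [|j r IH].
  by rewrite big_nil; under eq_fun do rewrite big_nil; exact: cvg_cst.
by rewrite big_cons; under eq_fun do rewrite big_cons; exact: cvgD.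
Qed.

(** * Representation of a bounded functional by a field *)

Section duality.
Context {R : realType} {dX : measure_display} {X : measurableType dX}
  {d : nat} (gamma : {measure set X -> \bar R}).

Definition duality_pairing (w v : 'I_d -> X -> R) (x : X) : R :=
  \sum_(i < d) w i x * v i x.

Lemma measurable_pairing (w v : 'I_d -> X -> R) :
  (forall i, measurable_fun setT (w i)) -> (forall i, measurable_fun setT (v i)) ->
  measurable_fun setT (duality_pairing w v).
Proof. by move=> mw mv; apply: measurable_sum => i; exact: measurable_funM. Qed.

Definition sgpowv (r : R) (u : 'I_d -> X -> R) : 'I_d -> X -> R :=
  fun i x => sgpow r (u i x).

Lemma measurable_sgpowv (r : R) u : 0 < r -> (forall i, measurable_fun setT (u i)) ->
  forall i, measurable_fun setT (sgpowv r u i).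
Proof.
move=> r0 mu i; apply: (@measurableT_comp _ _ _ _ _ _ (sgpow r)) => //.
by apply: continuous_measurable_fun; exact: cvg_sgpow.
Qed.

Lemma norm_pairing_le q (u v : 'I_d -> X -> R) x : 1 < q ->
  `|duality_pairing (sgpowv (q - 1) u) v x| <= powsum q u x + powsum q v x.
Proof.
move=> q1; rewrite /duality_pairing /powsum -big_split/=.
apply: (le_trans (ler_norm_sum _ _ _)); apply: ler_sum => i _.
by rewrite normrM norm_sgpow ?powR_young_le// subr_gt0.
Qed.

(** The tangent is taken at the moved point and evaluated at [u], so convexity alone bounds the
    energy increase by a pairing, without differentiating under the integral. *)
Lemma powsum_tangent q (u v : 'I_d -> X -> R) (s : R) x : 1 < q ->
  powsum q (fun i x => 1 * u i x + s * v i x) x <= powsum q u x +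
  s * q * duality_pairing (sgpowv (q - 1) (fun i x => 1 * u i x + s * v i x)) v x.
Proof.
move=> q1; rewrite /powsum /duality_pairing mulr_sumr -big_split/=.
apply: ler_sum => i _.
have := norm_powR_tangent q (1 * u i x + s * v i x) (u i x) q1.
rewrite /sgpowv mul1r (_ : u i x - (u i x + s * v i x) = - (s * v i x)); last by ring.
set P := _ `^ q; set Q := _ `^ q; set S := sgpow _ _ => H.
have -> : s * q * (S * v i x) = - (q * S * - (s * v i x)) by ring.
by rewrite -lerBlDr opprK.
Qed.

Lemma powsum_sgpowv q (u : 'I_d -> X -> R) x : 1 < q ->
  powsum (q / (q - 1)) (fun i x => q * sgpowv (q - 1) u i x) x =
  q `^ (q / (q - 1)) * powsum q u x.
Proof.
move=> q1; rewrite /powsum mulr_sumr; apply: eq_bigr => i _.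
rewrite normrM norm_sgpow ?subr_gt0// gtr0_norm ?(lt_trans _ q1)//.
rewrite powRM ?powR_ge0 ?ltW ?(lt_trans _ q1)//; congr (_ * _).
by rewrite -powRrM; congr (_ `^ _); field; rewrite gt_eqF// subr_gt0.
Qed.

(* [K] is the graph of a linear functional on a subspace of [L^q]. *)
Theorem Lq_duality (q : R) (K : ('I_d -> X -> R) -> R -> Prop) : 1 < q ->
  K (fun _ _ => 0) 0 ->
  (forall k l u a v b, K u a -> K v b ->
    K (fun i x => k * u i x + l * v i x) (k * a + l * b)) ->
  (forall u a, K u a -> inLq gamma q u) ->
  (forall u a, K u a -> Nq gamma q u <= 1 -> a <= 1) ->
  exists w : 'I_d -> X -> R, [/\ forall i, measurable_fun setT (w i),
    (\int[gamma]_x (powsum (q / (q - 1)) w x)%:E <=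
      (q `^ (q / (q - 1)) * (2 * q / (q - 1)))%:E)%E &
    forall v b, K v b ->
      gamma.-integrable setT (EFin \o duality_pairing w v) /\
      b = \int[gamma]_x duality_pairing w v x].
Proof.
move=> q1 K0 Klin KL Kle1; have q0 : 0 < q by rewrite (lt_trans _ q1).
have q10 : 0 < q - 1 by rewrite subr_gt0.
have eta0 k : 0 < (2 * 2 `^ q)^-1 ^+ k :> R.
  by rewrite exprn_gt0// invr_gt0 mulr_gt0// powR_gt0.
have [e [u [a [Ku Nu eB He HD]]]] :=
  maximizing_sequence gamma q q1 K K0 Klin KL Kle1 _ eta0.
have mu k i : measurable_fun setT (u k i) by case: (KL _ _ (Ku k)).
have [h [h0 ih mh [Z [mZ Z0 hZ]]]] := fast_cauchy_dominated gamma q q0 u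
  (fun k => KL _ _ (Klin 1 (-1) _ _ _ _ (Ku k.+1) (Ku k))) HD.
have {}hZ x : (~` Z) x -> forall k i, `|u k.+1 i x - u k i x| <= h x * 2^-1 ^+ k.
  by move=> nZx; apply: contrapT => H; apply: nZx; exact: hZ.
(* Setting the sequence to zero on the null set [Z] makes it converge at every point, so the limit
   [ub] is measurable. *)
pose v k i := (u k i) \_ (~` Z).
have mv k i : measurable_fun setT (v k i).
  apply/(measurable_restrictT _ _).1; first exact: measurableC.
  exact: measurable_funTS.
have vE k i x : (~` Z) x -> v k i x = u k i x.
  by move=> Zx; rewrite /v patchE mem_set.
have vZ k i x : Z x -> v k i x = 0.
  by move=> Zx; rewrite /v patchE memNset//=; apply.
have cv i x : cvgn (fun k => v k i x).
  have [Zx|Zx] := pselect (Z x).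
    by under eq_fun do rewrite vZ//; exact: is_cvg_cst.
  apply: (geometric_increment_cvg _ (h x)) => // k.
  by rewrite !vE// hZ.
pose ub i x := limn (fun k => v k i x).
have vub i x : v k i x @[k --> \oo] --> ub i x by exact: cv.
have mub i : measurable_fun setT (ub i).
  by apply: (measurable_fun_cvg (fun k => mv k i)) => x _; exact: vub.
exists (fun i x => q * sgpowv (q - 1) ub i x); split.
- by move=> i; apply: measurable_funM => //; exact: measurable_sgpowv.
- under eq_integral do rewrite powsum_sgpowv// EFinM.
  rewrite ge0_integralZl//; last 3 first.
  + by apply/measurable_EFinP; exact: measurable_powsum.
  + by move=> x _; rewrite lee_fin powsum_ge0.
  + by rewrite lee_fin powR_ge0.
  rewrite EFinM lee_wpmul2l ?lee_fin ?powR_ge0//.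
  have mf k : measurable_fun setT (EFin \o powsum q (v k)).
    by apply/measurable_EFinP; exact: measurable_powsum.
  have f0 k x : (0 <= (EFin \o powsum q (v k)) x)%E by rewrite lee_fin powsum_ge0.
  (* The energy of [v k] is at most that of [u k], hence at most [2 * q / (q - 1)]; Fatou's lemma
     passes this bound to [ub]. *)
  have := fatou gamma measurableT mf (fun k x _ => f0 k x).
  have fcv x : (EFin \o powsum q (v k)) x @[k --> \oo] --> (powsum q ub x)%:E.
    apply: cvg_EFin; first exact: nearW.
    apply: (cvg_sumr \oo _ (fun i k => `|v k i x| `^ q) (fun i => `|ub i x| `^ q)) => i.
    apply: (@cvg_comp _ _ _ (fun k => v k i x) (fun y : R => `|y| `^ q)).
      exact: vub.
    exact: cvg_norm_powR.
  under eq_integral do rewrite (cvg_limn_einf_sup (fcv _)).1.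
  move=> /le_trans; apply.
  rewrite limn_einf_lim; apply: lime_le; first exact: is_cvg_einfs.
  apply: nearW => n; apply: (@le_trans _ _ (\int[gamma]_x (EFin \o powsum q (v n)) x)%E).
    by apply: ereal_inf_lbound; exists n => /=.
  apply: (@le_trans _ _ (\int[gamma]_x (powsum q (u n) x)%:E)%E).
    apply: ge0_le_integral => //.
      by apply/measurable_EFinP; exact: measurable_powsum.
    move=> x _; rewrite lee_fin; apply: ler_sum => i _.
    have [Zx|Zx] := pselect (Z x); last by rewrite vE.
    by rewrite vZ// normr0 powR0 ?gt_eqF ?powR_ge0.
  by rewrite -EFin_Nq ?lee_fin//; exact: KL.
have pairingZ g x : duality_pairing (fun i x => q * sgpowv (q - 1) ub i x) g x =
    q * duality_pairing (sgpowv (q - 1) ub) g x.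
  by rewrite /duality_pairing mulr_sumr; apply: eq_bigr => i _; rewrite mulrA.
(* One inequality suffices: the opposite of [g], which [Klin] produces as [-1 * g + 0 * 0], gives
   the other. *)
suff main g b : K g b -> gamma.-integrable setT
      (EFin \o duality_pairing (sgpowv (q - 1) ub) g) /\
    b <= q * \int[gamma]_x duality_pairing (sgpowv (q - 1) ub) g x.
  move=> g b Kg; have [ig bg] := main _ _ Kg.
  have Kg' : K (fun i x => -1 * g i x + 0 * 0) (-1 * b + 0 * 0) := Klin (-1) 0 _ _ _ _ Kg K0.
  have [_] := main _ _ Kg'.
  have -> : \int[gamma]_x duality_pairing (sgpowv (q - 1) ub)
      (fun i x => -1 * g i x + 0 * 0) x =
    - \int[gamma]_x duality_pairing (sgpowv (q - 1) ub) g x.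
    rewrite -[RHS]mulN1r -(RintegralZl _ measurableT ig); apply: eq_Rintegral => x _.
    rewrite /duality_pairing mulr_sumr; apply: eq_bigr => i _.
    by rewrite mulr0 addr0 mulrCA.
  rewrite mulr0 addr0 mulN1r mulrN lerN2 => bg'.
  have -> : duality_pairing (fun i x => q * sgpowv (q - 1) ub i x) g =
      (fun x => q * duality_pairing (sgpowv (q - 1) ub) g x).
    by apply/funext => x; rewrite pairingZ.
  split; first exact: integrable_EFinZ.
  by rewrite RintegralZl//; apply/eqP; rewrite eq_le bg bg'.
move=> Kg.
have mg i : measurable_fun setT (g i) by case: (KL _ _ Kg).
have ig : gamma.-integrable setT (EFin \o powsum q g) by case: (KL _ _ Kg).
have iu k : gamma.-integrable setT (EFin \o powsum q (u k)) by case: (KL _ _ (Ku k)).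
(* The step tends to 0, while the defect [e k <= 4^-k] is at most its square. *)
pose s k : R := 2^-1 ^+ k.
have s0 k : 0 < s k by rewrite exprn_gt0.
have s1 k : s k <= 1 by rewrite exprn_ile1//; lra.
pose y k : 'I_d -> X -> R := fun i x => 1 * u k i x + s k * g i x.
have Ky k : K (y k) (1 * a k + s k * b) by exact: Klin.
have iy k : gamma.-integrable setT (EFin \o powsum q (y k)) by case: (KL _ _ (Ky k)).
have my k i : measurable_fun setT (y k i) by case: (KL _ _ (Ky k)).
pose f k := duality_pairing (sgpowv (q - 1) (y k)) g.
have mf k : measurable_fun setT (f k).
  by apply: measurable_pairing => //; apply: measurable_sgpowv.
have i_f k : gamma.-integrable setT (EFin \o f k).
  apply: (@le_integrable_EFin _ _ _ gamma (f k) (fun x => powsum q (y k) x + powsum q g x)) => //.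
    by move=> x; exact: norm_pairing_le.
  exact: integrable_EFinD.
(* Off [Z], [|y k|] is at most [|u 0| + 2 h + |g|] in each component, for every [k]. Splitting this
   sum of three terms twice gives the nested factors [2^q]; the same [h] counts once per component,
   hence [d]. *)
pose G x := 2 `^ q * (2 `^ q * (powsum q (u 0%N) x + d%:R * (2 `^ q * h x `^ q)) +
  powsum q g x) + powsum q g x.
have iG : gamma.-integrable setT (EFin \o G).
  apply: integrable_EFinD => //; apply: integrable_EFinZ.
  apply: integrable_EFinD => //; apply: integrable_EFinZ.
  by apply: integrable_EFinD => //; do 2 apply: integrable_EFinZ.
have fG : {ae gamma, forall x n, [set: X] x -> (`|(EFin \o f n) x| <= (EFin \o G) x)%E}.
  exists Z; split => // x /= nfG; apply: contrapT => Zx; apply: nfG => n _.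
  rewrite lee_fin; apply: (le_trans (norm_pairing_le _ _ _ _ q1)).
  rewrite lerD2r.
  have -> : d%:R * (2 `^ q * h x `^ q) = \sum_(i < d) 2 `^ q * h x `^ q.
    by rewrite sumr_const card_ord mulr_natl.
  rewrite /powsum -big_split/= mulr_sumr -big_split/= mulr_sumr.
  apply: ler_sum => i _.
  apply: (@le_trans _ _ ((`|u 0%N i x| + 2 * h x + `|g i x|) `^ q)).
    apply: ge0_ler_powR; rewrite ?nnegrE ?addr_ge0 ?mulr_ge0 ?(ltW q0)//.
    rewrite /y mul1r (le_trans (ler_normD _ _))// lerD//.
      exact: (geometric_increment_bound (fun k => u k i x) (h x) (h0 x) (fun k => hZ x Zx k i)).
    by rewrite normrM gtr0_norm// ler_piMl.
  apply: (le_trans (powRD_le _ _ _ q0 _ _)); rewrite ?addr_ge0 ?mulr_ge0//.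
  rewrite ler_wpM2l ?powR_ge0// lerD2r.
  apply: (le_trans (powRD_le _ _ _ q0 _ _)); rewrite ?mulr_ge0//.
  by rewrite powRM.
have fcv : {ae gamma, forall x, [set: X] x ->
    (EFin \o f n) x @[n --> \oo] --> (EFin \o duality_pairing (sgpowv (q - 1) ub) g) x}.
  exists Z; split => // x /= nfG; apply: contrapT => Zx; apply: nfG => _.
  apply: cvg_EFin; first exact: nearW.
  apply: (cvg_sumr \oo _ (fun i k => sgpow (q - 1) (y k i x) * g i x)
    (fun i => sgpow (q - 1) (ub i x) * g i x)) => i.
  apply: cvgM; last exact: cvg_cst.
  apply: (@cvg_comp _ _ _ (fun k => y k i x) (sgpow (q - 1))); last first.
    exact: cvg_sgpow.
  suff : y k i x @[k --> \oo] --> ub i x + 0 * g i x by rewrite mul0r addr0.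
  apply: cvgD.
    under eq_fun do rewrite mul1r.
    by have := vub i x; under eq_fun do rewrite vE//.
  apply: cvgM; last exact: cvg_cst.
  by apply: cvg_expr; rewrite ger0_norm//; lra.
have mlim : measurable_fun setT (EFin \o duality_pairing (sgpowv (q - 1) ub) g).
  by apply/measurable_EFinP; apply: measurable_pairing => //; exact: measurable_sgpowv.
have [ilim _ clim] := dominated_convergence measurableT
  (fun n => (measurable_EFinP _ _).2 (mf n)) mlim fcv iG fG.
split => //.
have clim' : q * \int[gamma]_x f k x + s k @[k --> \oo] -->
    q * \int[gamma]_x duality_pairing (sgpowv (q - 1) ub) g x + 0.
  apply: cvgD; last by apply: cvg_expr; rewrite ger0_norm//; lra.
  apply: cvgM; first exact: cvg_cst.
  by apply: fine_cvg; rewrite fineK//; exact: integrable_fin_num.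
rewrite -[leRHS]addr0 -(cvg_lim (@Rhausdorff R) clim').
apply: limr_ge; first by apply/cvg_ex; eexists; exact: clim'.
apply: nearW => k.
(* Maximality tested at [y k], almost maximality of [u k] and the tangent bound combine into
   [s k * b <= e k + s k * q * I], where [I] is the integral of [f k]; then [s k] is divided out. *)
have H1 := le_energy_sup gamma q q1 K K0 Klin KL Kle1 _ _ (Ky k).
have H2 := He k.
have H3 : Nq gamma q (y k) <= Nq gamma q (u k) + s k * q * \int[gamma]_x f k x.
  rewrite -RintegralZl// -RintegralD//; last exact: integrable_EFinZ.
  apply: le_Rintegral => //.
    by apply: integrable_EFinD => //; exact: integrable_EFinZ.
  by move=> x _; exact: powsum_tangent.
have H4 : e k <= s k * s k.
  have /andP[_ /le_trans] := eB k; apply.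
  by rewrite -exprMn -invfM -natrM.
have H5 : s k * b <= s k * (s k + q * \int[gamma]_x f k x).
  move: H1 H2 H3 H4; move: (energy_sup _ _ _) (Nq _ _ _) (Nq _ _ _) (\int[gamma]_x f k x).
  move: (s k) (a k) (e k) => sk ak ek S N1 N2 I; rewrite mulrDr mulrA; lra.
by rewrite addrC -(ler_pM2l (s0 k)).
Qed.

End duality.

(** * Test functions on [R^d] *)

Lemma compact_supp_bounded {R : realType} {T : topologicalType} (f : T -> R) (K : set T) :
  continuous f -> compact K -> (forall x, ~ K x -> f x = 0) ->
  exists M, 0 <= M /\ forall x, `|f x| <= M.
Proof.
move=> cf cK f0.
have : compact (f @` K) by apply: continuous_compact => //; exact: continuous_subspaceT.
move=> /(@compact_bounded R R^o) [M [_ HM]].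
exists (`|M| + 1); split => [|x]; first by rewrite addr_ge0.
have [Kx|/f0 ->] := pselect (K x); last by rewrite normr0 addr_ge0.
by apply: HM; [rewrite ltr_pwDr// ler_norm|exists x].
Qed.

Section euclidean.
Context {R : realType} {d : nat}.
Local Notation V := 'rV[R]_d.
Implicit Types (x y : V) (f g : V -> R) (m : {measure set (Rd R d) -> \bar R}).

Lemma continuous_measurable_Rd f : continuous f ->
  measurable_fun [set: Rd R d] (f : Rd R d -> R).
Proof.
move=> /continuousP cf; apply: (measurability _ (RGenOpens.measurableE R)).
move=> _ [_ [a [b ->] <-]]; rewrite setTI.
by apply: sub_sigma_algebra; apply: cf; exact: interval_open.
Qed.

Lemma enorm_ge0 x : 0 <= enorm x. Proof. exact: sqrtr_ge0. Qed.

Lemma enorm_le_sum x : enorm x <= \sum_(i < d) `|x ord0 i|.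
Proof.
have s0 : 0 <= \sum_(i < d) `|x ord0 i| by apply: sumr_ge0.
rewrite /enorm -(ger0_norm s0) -sqrtr_sqr ler_sqrt ?sqr_ge0//.
rewrite expr2 mulr_suml; apply: ler_sum => i _.
rewrite (le_trans (ler_norm _))// normrM ler_wpM2l//.
by rewrite (bigD1 i)//= lerDl sumr_ge0.
Qed.

(** Each component is at most [S^(1/q)], so the Euclidean norm is at most [d] times that. *)
Lemma enorm_powR_le q x : 0 < q ->
  enorm x `^ q <= d%:R `^ q * \sum_(i < d) `|x ord0 i| `^ q.
Proof.
move=> q0; set S := \sum_(i < d) _ `^ _.
have S0 : 0 <= S by apply: sumr_ge0 => i _; exact: powR_ge0.
have SE : S = (S `^ q^-1) `^ q by rewrite -powRrM mulVf ?gt_eqF// powRr1.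
rewrite [in leRHS]SE -powRM ?ler0n ?powR_ge0//.
apply: ge0_ler_powR; rewrite ?nnegrE ?enorm_ge0 ?mulr_ge0 ?ler0n ?powR_ge0 ?(ltW q0)//.
apply: (le_trans (enorm_le_sum x)).
have -> : d%:R * S `^ q^-1 = \sum_(i < d) S `^ q^-1 by rewrite sumr_const card_ord mulr_natl.
apply: ler_sum => i _.
rewrite -[leLHS]powRr1// -(mulfV (negbT (gt_eqF q0))) powRrM.
apply: ge0_ler_powR; rewrite ?nnegrE ?powR_ge0 ?invr_ge0 ?(ltW q0)//.
by rewrite /S (bigD1 i)//= lerDl sumr_ge0// => j _; exact: powR_ge0.
Qed.

Lemma continuous_enorm : continuous (@enorm R d).
Proof.
move=> x; apply: (@continuous_comp _ _ _ (fun x : V => dotv x x) (@Num.sqrt R)).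
  apply: (cvg_sumr (nbhs x) _ (fun i y => y ord0 i * y ord0 i) (fun i => x ord0 i * x ord0 i)) => i.
  by apply: cvgM; exact: coord_continuous.
exact: sqrt_continuous.
Qed.

Lemma measurable_enorm : measurable_fun [set: Rd R d] (@enorm R d : Rd R d -> R).
Proof. by apply: continuous_measurable_Rd; exact: continuous_enorm. Qed.

Lemma measurable_eball r : measurable (eball (0 : V) r).
Proof.
have -> : eball (0 : V) r = [set: Rd R d] `&` (@enorm R d : Rd R d -> R) @^-1` `]-oo, r[%classic.
  by rewrite setTI; apply/seteqP; split => x; rewrite /eball/= in_itv/= subr0.
by apply: measurable_enorm => //; exact: measurable_itv.
Qed.

Lemma compact_sub_eball (K : set V) : compact K -> exists r, K `<=` eball 0 r.
Proof.
move=> /compact_bounded [M [_ HM]].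
exists (d%:R * (`|M| + 1) + 1) => x Kx; rewrite /eball/= subr0.
apply: (le_lt_trans (enorm_le_sum x)).
apply: (@le_lt_trans _ _ (d%:R * (`|M| + 1))); last by rewrite ltrDl.
have -> : d%:R * (`|M| + 1) = \sum_(i < d) (`|M| + 1) by rewrite sumr_const card_ord mulr_natl.
apply: ler_sum => i _.
apply: (@le_trans _ _ `|x|).
  rewrite [leRHS]/Num.norm/= mx_normrE.
  by apply/bigmax_geP; right; exists (ord0, i).
by apply: HM => //; rewrite ltr_pwDr// ler_norm.
Qed.

Lemma eball_indic_integrable m r (M : R) : locfin m ->
  m.-integrable [set: Rd R d] (EFin \o (fun x => M * \1_(eball (0 : V) r) x)).
Proof.
move=> lm; apply: integrable_EFinZ; apply/integrableP.
have mB := measurable_eball r.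
split; first by apply/measurable_EFinP; exact: measurable_indic.
under eq_integral do rewrite gee0_abs ?lee_fin//.
by rewrite integral_indic// setIT.
Qed.

Lemma supp_bound_integrable m f r M : locfin m -> measurable_fun [set: Rd R d] (f : Rd R d -> R) ->
  (forall x, `|f x| <= M * \1_(eball (0 : V) r) x) ->
  m.-integrable [set: Rd R d] (EFin \o (f : Rd R d -> R)).
Proof.
move=> lm mf fM; apply: (@le_integrable_EFin _ _ _ m f _ mf fM).
exact: eball_indic_integrable.
Qed.

Lemma Cc_bound f : Cc f -> exists M r, 0 <= M /\ forall x, `|f x| <= M * \1_(eball (0 : V) r) x.
Proof.
move=> [cf [K [cK f0]]].
have [M [M0 HM]] := compact_supp_bounded f K cf cK f0.
have [r Kr] := compact_sub_eball K cK.
exists M, r; split => // x; rewrite indicE.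
case: (boolP (x \in eball 0 r)) => [_|]; first by rewrite mulr1.
move=> /negP xr; rewrite mulr0 f0 ?normr0// => Kx; apply: xr.
by rewrite inE; exact: Kr.
Qed.

Lemma Cc_integrable m f : locfin m -> Cc f ->
  m.-integrable [set: Rd R d] (EFin \o (f : Rd R d -> R)).
Proof.
move=> lm /[dup] [[cf _]] /Cc_bound[M [r [_ fM]]].
by apply: (supp_bound_integrable m f r M) => //; exact: continuous_measurable_Rd.
Qed.

Lemma CcZD (k l : R) f g : Cc f -> Cc g -> Cc (fun x => k * f x + l * g x).
Proof.
move=> [cf [K [cK f0]]] [cg [H [cH g0]]]; split.
  by move=> x; exact: (cvgD (cvgM (cvg_cst k) (cf x)) (cvgM (cvg_cst l) (cg x))).
exists (K `|` H); split; first exact: compactU.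
by move=> x /not_orP[Kx Hx]; rewrite f0// g0// !mulr0 addr0.
Qed.

Lemma C1c_Cc f : C1c f -> Cc f. Proof. by case. Qed.

(** The compact [K] is closed, so [f] vanishes near each point outside it, and its derivatives
    vanish there. *)
Lemma C1c_pd f i : C1c f -> Cc (pd f i).
Proof.
move=> [[cf [K [cK f0]]] [df cp]]; split; first exact: cp.
exists K; split => // x Kx; rewrite /pd.
have oK : open (~` K) by apply: closed_openC; apply: compact_closed => //; exact: norm_hausdorff.
rewrite (@near_eq_derive _ _ _ f (cst 0)) ?derive_cst//.
by near=> y; apply: f0; near: y; exact: open_nbhs_nbhs.
Unshelve. all: by end_near. Qed.

Lemma pdZD (k l : R) f g (i : 'I_d) x :
  derivable f x (@ei R d i) -> derivable g x (@ei R d i) ->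
  pd (fun x => k * f x + l * g x) i x = k * pd f i x + l * pd g i x.
Proof.
move=> df dg; rewrite /pd.
rewrite (_ : (fun x => _) = (k \*: (f : V -> R^o)) + (l \*: (g : V -> R^o)))//.
by rewrite (deriveD (derivableZ df) (derivableZ dg)) (deriveZ _ df) (deriveZ _ dg).
Qed.

Lemma C1cZD (k l : R) f g : C1c f -> C1c g -> C1c (fun x => k * f x + l * g x).
Proof.
move=> C1f C1g; have [Cf [df cf]] := C1f; have [Cg [dg cg]] := C1g.
split; first exact: CcZD.
split=> [x i|i].
  rewrite (_ : (fun x => _) = (k \*: (f : V -> R^o)) + (l \*: (g : V -> R^o)))//.
  by apply: derivableD; exact: derivableZ.
rewrite (_ : pd _ i = fun x => k * pd f i x + l * pd g i x); last first.
  by apply/funext => x; exact: pdZD.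
by have [] := CcZD k l _ _ (C1c_pd f i C1f) (C1c_pd g i C1g).
Qed.

Lemma C1c0 : C1c (fun _ : V => 0 : R).
Proof.
split; first by split; [exact: cst_continuous|exists set0; split => //; exact: compact0].
split=> [x i|i]; first exact: derivable_cst.
rewrite (_ : pd _ i = cst 0); first exact: cst_continuous.
by apply/funext => x; exact: (@derive_cst R V R^o 0 x (ei R i)).
Qed.

Lemma pd_inLq q m f : 0 < q -> locfin m -> C1c f ->
  inLq m q (fun i (x : Rd R d) => pd f i x).
Proof.
move=> q0 lm C1f; split.
  by move=> i; apply: continuous_measurable_Rd; have [] := C1c_pd f i C1f.
apply: Cc_integrable => //; split.
  move=> x; apply: (cvg_sumr (nbhs x) _ (fun i y => `|pd f i y| `^ q)
    (fun i => `|pd f i x| `^ q)) => i.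
  apply: (cvg_comp (pd f i) (fun y : R => `|y| `^ q) _ (cvg_norm_powR _ q0 (pd f i x))).
  by have [+ _] := C1c_pd f i C1f; apply.
have [_ [K [cK f0]]] := C1c_Cc f C1f.
have oK : open (~` K) by apply: closed_openC; apply: compact_closed => //; exact: norm_hausdorff.
exists K; split => // x Kx; rewrite /powsum big1// => i _.
rewrite /pd (@near_eq_derive _ _ _ f (cst 0)) ?derive_cst//; first by rewrite normr0 powR0 ?gt_eqF.
by near=> y; apply: f0; near: y; exact: open_nbhs_nbhs.
Unshelve. all: by end_near. Qed.

End euclidean.

(** * Linear interpolation of measures *)

Section interpolation.
Context {R : realType} {dX : measure_display} {X : measurableType dX}.
Implicit Types (m : {measure set X -> \bar R}) (f : X -> R) (k : {nonneg R}).

Lemma integrable_mscale k m f : m.-integrable setT (EFin \o f) ->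
  (mscale k m).-integrable setT (EFin \o f).
Proof.
move=> /integrableP[mf foo]; apply/integrableP; split => //.
by rewrite ge0_integral_mscale ?lte_mul_pinfty//; exact: measurableT_comp.
Qed.

Lemma Rintegral_mscale k m f : m.-integrable setT (EFin \o f) ->
  \int[mscale k m]_x f x = k%:num * \int[m]_x f x.
Proof.
move=> intf; have [mf _] := integrableP _ _ _ intf.
rewrite /Rintegral [in LHS]integralE [in RHS]integralE !ge0_integral_mscale//;
  [|exact: measurable_funeneg|exact: measurable_funepos].
have := integrable_neg_fin_num measurableT intf; have := integrable_pos_fin_num measurableT intf.
move=> /fineK <- /fineK <-.
by rewrite -!EFinM -!EFinB/= mulrBr.
Qed.

Lemma Rintegral_measure_add m1 m2 f :
  m1.-integrable setT (EFin \o f) -> m2.-integrable setT (EFin \o f) ->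
  \int[measure_add m1 m2]_x f x = \int[m1]_x f x + \int[m2]_x f x.
Proof.
move=> i1 i2; have [mf _] := integrableP _ _ _ i1.
by rewrite /Rintegral integral_measure_add// fineD// integrable_fin_num.
Qed.

(** The absolute values make the weights nonnegative for all real [t], so that this is always a
    measure; it is the linear interpolation for [t] in [[0, 1]]. *)
Definition interp_meas m0 m1 (t : R) : {measure set X -> \bar R} :=
  measure_add (mscale (NngNum (normr_ge0 (1 - t))) m0)
              (mscale (NngNum (normr_ge0 t)) m1).

Lemma interp_measE m0 m1 t A :
  interp_meas m0 m1 t A = (`|1 - t|%:E * m0 A + `|t|%:E * m1 A)%E.
Proof. exact: measure_addE. Qed.

Lemma Rintegral_interp m0 m1 t f :
  m0.-integrable setT (EFin \o f) -> m1.-integrable setT (EFin \o f) ->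
  \int[interp_meas m0 m1 t]_x f x = `|1 - t| * \int[m0]_x f x + `|t| * \int[m1]_x f x.
Proof.
move=> i0 i1.
rewrite -(Rintegral_mscale (NngNum (normr_ge0 (1 - t))))//.
rewrite -(Rintegral_mscale (NngNum (normr_ge0 t)))//.
by apply: Rintegral_measure_add; exact: integrable_mscale.
Qed.

End interpolation.

(** * From the dual norm to a flux *)

Section vector_field.
Context {R : realType} {d : nat}.
Local Notation V := 'rV[R]_d.
Local Notation meas := {measure set (Rd R d) -> \bar R}.
Implicit Types (f g : V -> R) (m : meas).

Lemma Rintegral_CcZD m (k l : R) f g : locfin m -> Cc f -> Cc g ->
  Rintegral m [set: Rd R d] (fun x => k * f x + l * g x) =
  k * Rintegral m [set: Rd R d] f + l * Rintegral m [set: Rd R d] g.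
Proof.
move=> lm Cf Cg.
have intf := Cc_integrable m f lm Cf.
have intg := Cc_integrable m g lm Cg.
have intkf := @integrable_EFinZ _ _ _ m k _ intf.
have intlg := @integrable_EFinZ _ _ _ m l _ intg.
by rewrite (RintegralD measurableT intkf intlg) (RintegralZl _ measurableT intf)
  (RintegralZl _ measurableT intg).
Qed.

Lemma dual_vector_field (q D : R) (gamma mu0 mu1 : meas) : 1 < q -> 0 < D ->
  locfin gamma -> locfin mu0 -> locfin mu1 ->
  (dualnorm q gamma mu0 mu1 <= D%:E)%E ->
  exists w : 'I_d -> Rd R d -> R, [/\ forall i, measurable_fun setT (w i),
    (\int[gamma]_x (powsum (q / (q - 1)) w x)%:E <=
      ((d.+1%:R * D) `^ (q / (q - 1)) * (q `^ (q / (q - 1)) * (2 * q / (q - 1))))%:E)%E &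
    forall f, C1c f ->
      Rintegral mu1 [set: Rd R d] f - Rintegral mu0 [set: Rd R d] f =
      \int[gamma]_x duality_pairing w (fun i (x : Rd R d) => pd f i x) x].
Proof.
move=> q1 D0 lg l0 l1 HD; have q0 : 0 < q by rewrite (lt_trans _ q1).
have d0 : 0 < d.+1%:R :> R by rewrite ltr0n.
(* Dividing by [D] normalizes the functional, and [d + 1] pays for the componentwise energy; unlike
   [d], it is positive also in dimension 0. *)
pose kap := d.+1%:R * D; have kap0 : 0 < kap by rewrite mulr_gt0.
pose ell f := Rintegral mu1 [set: Rd R d] f - Rintegral mu0 [set: Rd R d] f.
have ellZD k l f g : C1c f -> C1c g ->
    ell (fun x => k * f x + l * g x) = k * ell f + l * ell g.
  move=> /C1c_Cc Cf /C1c_Cc Cg; rewrite /ell !Rintegral_CcZD//; ring.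
(* As a relation, [K] does not require that the value depend on the gradient alone; the bound on the
   unit ball takes care of this. *)
pose K (u : 'I_d -> Rd R d -> R) a := exists f, [/\ C1c f,
  u = (fun i (x : Rd R d) => pd f i x) & a = kap^-1 * ell f].
have [||||w [mw wq Hw]] := @Lq_duality R _ (Rd R d) d gamma q K q1.
- exists (fun _ => 0); split; first exact: C1c0.
    by apply/funext => i; apply/funext => x; rewrite /pd (derive_cst (0 : R^o)).
  by rewrite /ell !Rintegral_cst// !mul0r subrr mulr0.
- move=> k l _ _ _ _ [f [Cf -> ->]] [g [Cg -> ->]].
  exists (fun x => k * f x + l * g x); split; first exact: C1cZD.
    apply/funext => i; apply/funext => x; rewrite pdZD//.
      by have [_ [+ _]] := Cf; apply.
    by have [_ [+ _]] := Cg; apply.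
  by rewrite ellZD//; ring.
- by move=> _ _ [f [Cf -> _]]; exact: pd_inLq.
- move=> _ _ [f [Cf -> ->]] N1.
  have Lf := pd_inLq q gamma f q0 lg Cf.
  rewrite mulrC ler_pdivrMr// mul1r.
  (* The sign accounts for [dualnorm] pairing with [mu0 - mu1] and [ell] with [mu1 - mu0]; the size
     turns the norm comparison into [(d / (d + 1))^q <= 1]. *)
  pose k : R := - d.+1%:R^-1.
  pose z x := k * f x + 0 * (fun _ => 0) x.
  have Cz : C1c z by apply: C1cZD => //; exact: C1c0.
  have zg x : (enorm (grad z x) `^ q <= powsum q (fun i (x : Rd R d) => pd f i x) x).
    apply: (le_trans (enorm_powR_le q _ q0)); rewrite mulr_sumr.
    apply: ler_sum => i _; rewrite mxE /z pdZD; last 2 first.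
    + by have [_ [+ _]] := Cf; apply.
    + exact: derivable_cst.
    have kE : `|k| = d.+1%:R^-1 by rewrite normrN gtr0_norm ?invr_gt0.
    rewrite mul0r addr0 normrM kE.
    have dV0 : 0 <= d.+1%:R^-1 :> R by rewrite invr_ge0 ltW.
    rewrite (powRM _ dV0 (normr_ge0 _)) mulrA -(powRM _ (ler0n _ d) dV0).
    rewrite ler_piMl ?powR_ge0//.
    rewrite -[leRHS](_ : 1 `^ q = 1); last by rewrite powR1.
    apply: ge0_ler_powR; rewrite ?nnegrE ?mulr_ge0 ?(ltW q0)//.
    by rewrite ler_pdivrMr// mul1r ler_nat.
  have zI : (\int[gamma]_(x in [set: Rd R d]) ((enorm (grad z x)) `^ q)%:E <= 1)%E.
    apply: (@le_trans _ _ (\int[gamma]_x (powsum q (fun i (x : Rd R d) =>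
      pd f i x) x)%:E)%E); last first.
      by rewrite -EFin_Nq// lee_fin.
    apply: ge0_le_integral => //.
    + by move=> x _; rewrite lee_fin powR_ge0.
    + apply/measurable_EFinP.
      apply: (@measurableT_comp _ _ _ _ _ _ (fun x : R => x `^ q)).
        exact: measurable_powR.
      apply: (@measurableT_comp _ _ _ _ _ _ (@Num.sqrt R)).
        exact: continuous_measurable_fun (@sqrt_continuous R).
      apply: measurable_sum => i.
      have mpd : measurable_fun [set: Rd R d] (fun x : Rd R d => grad z x ord0 i).
        under eq_fun do rewrite mxE.
        by apply: continuous_measurable_Rd; have [_ [_ +]] := Cz; apply.
      exact: measurable_funM.
    + by apply/measurable_EFinP; apply: measurable_powsum; case: Lf.
    + by move=> x _; rewrite lee_fin.
  have := le_trans (ereal_sup_ubound _) HD.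
  move=> /(_ (Rintegral mu0 [set: Rd R d] z - Rintegral mu1 [set: Rd R d] z)%:E).
  rewrite lee_fin => /(_ _)H; have {}H := H _.
  have : ell f = - d.+1%:R * ell z.
    rewrite /z ellZD//; last exact: C1c0.
    by rewrite mul0r addr0 /k mulrA mulrNN mulfV ?gt_eqF// mul1r.
  move=> ->; rewrite mulNr -mulrN /kap ler_pM2l// /ell opprB.
  by apply: H; exists z.
exists (fun i x => kap * w i x); split.
- by move=> i; exact: measurable_funM.
- under eq_integral do rewrite powsumZ EFinM.
  rewrite ge0_integralZl//; last 2 first.
  + by apply/measurable_EFinP; exact: measurable_powsum.
  + by move=> x _; rewrite lee_fin powsum_ge0.
  by rewrite gtr0_norm// EFinM lee_wpmul2l// lee_fin powR_ge0.
- move=> f Cf.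
  have [|ig Hf] := Hw (fun i (x : Rd R d) => pd f i x) (kap^-1 * ell f).
    by exists f.
  have -> : duality_pairing (fun i x => kap * w i x) (fun i (x : Rd R d) => pd f i x) =
      (fun x => kap * duality_pairing w (fun i (x : Rd R d) => pd f i x) x).
    apply/funext => x; rewrite /duality_pairing mulr_sumr.
    by apply: eq_bigr => i _; rewrite mulrA.
  by rewrite RintegralZl// -Hf mulrA mulfV ?gt_eqF// mul1r.
Qed.

End vector_field.

(** * Linear interpolation and the continuity equation *)

Section spacetime.
Context {R : realType} {d : nat}.
Local Notation V := 'rV[R]_d.
Local Notation meas := {measure set (Rd R d) -> \bar R}.
Implicit Types (m : meas).

(** The bound is uniform in [t] and integrable for every locally finite measure: it is the
    dominating function for continuity and differentiation in time. *)
Lemma spacetime_bound (F : V * R -> R) (K : set (V * R)) : continuous F ->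
  compact K -> (forall p, ~ K p -> F p = 0) ->
  exists M r, forall x t, `|F (x, t)| <= M * \1_(eball (0 : V) r) x.
Proof.
move=> cF cK F0; have [M [M0 HM]] := compact_supp_bounded F K cF cK F0.
have cK1 : compact (fst @` K).
  by apply: continuous_compact => //; apply: continuous_subspaceT => p; exact: cvg_fst.
have [r Kr] := compact_sub_eball _ cK1.
exists M, r => x t; rewrite indicE.
case: (boolP (x \in eball 0 r)) => [_|]; first by rewrite mulr1.
move=> /negP xr; rewrite mulr0 F0 ?normr0// => Kx; apply: xr.
by rewrite inE; apply: Kr; exists (x, t).
Qed.

Lemma continuous_pairl (t : R) : continuous (fun x : V => (x, t)).
Proof.
move=> x A [[B C] [/= nB nC] BCA]; apply: filterS nB => y By.
by apply: BCA; split => //=; exact: nbhs_singleton.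
Qed.

Lemma continuous_pairr (x : V) : continuous (fun t : R => (x, t)).
Proof.
move=> t A [[B C] [/= nB nC] BCA]; apply: filterS nC => s Cs.
by apply: BCA; split => //=; exact: nbhs_singleton.
Qed.

Lemma spacetime_integrable m (F : V * R -> R) M r t : locfin m -> continuous F ->
  (forall x t, `|F (x, t)| <= M * \1_(eball (0 : V) r) x) ->
  m.-integrable setT (EFin \o (fun x : Rd R d => F (x, t))).
Proof.
move=> lm cF HF; apply: (supp_bound_integrable m (fun x => F (x, t)) r M) => //.
apply: continuous_measurable_Rd => x.
apply: (continuous_comp (f := fun x : V => (x, t)) (g := F)); last exact: cF.
exact: continuous_pairl.
Qed.

Lemma spacetime_integral_continuous m (F : V * R -> R) M r : locfin m -> continuous F ->
  (forall x t, `|F (x, t)| <= M * \1_(eball (0 : V) r) x) ->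
  continuous (fun t => Rintegral m [set: Rd R d] (fun x => F (x, t))).
Proof.
move=> lm cF HF t0.
have H := @continuity_under_integral R _ (Rd R d) m (fun t x => F (x, t)) setT
  measurableT (t0 - 1) (t0 + 1) _ _ _ (eball_indic_integrable m r M lm) _ t0.
apply: H.
- by move=> t _; exact: spacetime_integrable.
- apply: aeW => x _ t _.
  apply: (continuous_comp (f := fun t => (x, t)) (g := F)); last exact: cF.
  exact: continuous_pairr.
- by move=> t _; apply: aeW => x _; exact: HF.
- by rewrite inE/= in_itv/=; lra.
Qed.

Lemma spacetime_integral_derive m (z : V -> R -> R) M1 r1 M2 r2 : locfin m ->
  continuous (fun p : V * R => z p.1 p.2) ->
  (forall x t, `|z x t| <= M1 * \1_(eball (0 : V) r1) x) ->
  (forall x t, derivable (z x) t 1) ->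
  (forall x t, `|derive (z x) t 1| <= M2 * \1_(eball (0 : V) r2) x) ->
  forall t, is_derive t (1 : R) (fun t => Rintegral m [set: Rd R d] (fun x => z x t))
    (Rintegral m [set: Rd R d] (fun x => derive (z x) t 1)).
Proof.
move=> lm cz bz dz bd t0.
have It : `]t0 - 1, t0 + 1[%classic t0 by rewrite /= in_itv/=; lra.
have dzE t x : partial1of2 (fun t (x : Rd R d) => z x t) t x = derive (z x) t 1.
  by rewrite partial1of2E.
have intz t : `]t0 - 1, t0 + 1[%classic t ->
    m.-integrable setT (EFin \o (fun x : Rd R d => z x t)).
  move=> _; exact: (spacetime_integrable m (fun p : V * R => z p.1 p.2) M1 r1 t lm cz bz).
have G0 y : 0 <= M2 * \1_(eball (0 : V) r2) y.
  by rewrite (le_trans (normr_ge0 _) (bd y 0)).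
have bnd t y : `]t0 - 1, t0 + 1[%classic t -> [set: Rd R d] y ->
    `|partial1of2 (fun t (x : Rd R d) => z x t) t y| <= M2 * \1_(eball (0 : V) r2) y.
  by move=> _ _; rewrite dzE.
have derf t y : `]t0 - 1, t0 + 1[%classic t -> [set: Rd R d] y ->
    derivable (fun s => z y s) t 1 by move=> _ _; exact: dz.
have iG := eball_indic_integrable m r2 M2 lm.
apply: DeriveDef.
  exact: (@derivable_under_integral R _ (Rd R d) m (fun t x => z x t) setT
    measurableT t0 _ _ It intz derf _ G0 iG bnd).
rewrite -derive1E.
rewrite (@differentiation_under_integral R _ (Rd R d) m (fun t x => z x t) setT
    measurableT t0 _ _ It intz derf _ G0 iG bnd).
by apply: eq_Rintegral => x _; rewrite dzE.
Qed.

Lemma C1c_st_section (T : R) (z : V -> R -> R) t : C1c_st T z -> C1c (fun x => z x t).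
Proof.
move=> [cz [[K [cK [Kt z0]]] [dx [cdx _]]]].
split; last first.
  split=> [x i|i x]; first exact: dx.
  apply: (continuous_comp (f := fun x : V => (x, t))
    (g := fun p : V * R => pd (fun y => z y p.2) i p.1)); last exact: cdx.
  exact: continuous_pairl.
split.
  move=> x; apply: (continuous_comp (f := fun x : V => (x, t))
    (g := fun p : V * R => z p.1 p.2)); last exact: cz.
  exact: continuous_pairl.
exists (fst @` K); split.
  by apply: continuous_compact => //; apply: continuous_subspaceT => p; exact: cvg_fst.
by move=> x Kx; apply: (z0 (x, t)) => Kxt; apply: Kx; exists (x, t).
Qed.

Lemma C1c_st_derive_supp (z : V -> R -> R) (K : set (V * R)) : compact K ->
  (forall p, ~ K p -> z p.1 p.2 = 0) ->
  forall p, ~ K p -> derive (z p.1) p.2 1 = 0.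
Proof.
move=> cK z0 [x t] Kp /=.
have oK : open (~` K).
  by apply: closed_openC; apply: compact_closed => //; exact: norm_hausdorff.
have nK : nbhs (x, t) (~` K) by exact: open_nbhs_nbhs.
rewrite (@near_eq_derive R R^o R^o (z x) (cst 0)) ?derive_cst//.
have : \forall s \near t, (~` K) (x, s) by exact: (continuous_pairr x t).
by apply: filterS => s Ks; exact: (z0 (x, s)).
Qed.

(* The sum of the two integrands is the time derivative of
   [(1 - t) \int z_t dmu0 + t \int z_t dmu1], which vanishes at both end points. *)
Lemma interp_continuity_equation (mu0 mu1 : meas) (z : V -> R -> R) (g : R -> R) :
  locfin mu0 -> locfin mu1 -> C1c_st 1 z ->
  (forall t, g t = Rintegral mu1 [set: Rd R d] (fun x => z x t) -
                   Rintegral mu0 [set: Rd R d] (fun x => z x t)) ->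
  Rintegral lebesgue_measure `]0, 1[
    (fun t => Rintegral (interp_meas mu0 mu1 t) [set: Rd R d] (fun x => derive (z x) t 1)) +
  Rintegral lebesgue_measure `]0, 1[ g = 0.
Proof.
move=> l0 l1 [cz [[K [cK [Kt z0]]] [_ [_ [dt cdt]]]]] gE.
have [M1 [r1 b1]] := spacetime_bound _ K cz cK z0.
have [M2 [r2 b2]] := spacetime_bound _ K cdt cK (C1c_st_derive_supp z K cK z0).
pose G m t := Rintegral m [set: Rd R d] (fun x => z x t).
pose H m t := Rintegral m [set: Rd R d] (fun x => derive (z x) t 1).
have dG m t : locfin m -> is_derive t (1 : R) (G m) (H m t).
  by move=> lm; exact: (spacetime_integral_derive m z M1 r1 M2 r2).
have cG m : locfin m -> continuous (G m).
  by move=> lm; exact: (spacetime_integral_continuous m _ M1 r1 lm cz).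
have cH m : locfin m -> continuous (H m).
  by move=> lm; exact: (spacetime_integral_continuous m _ M2 r2 lm cdt).
pose h t := (1 - t) * H mu0 t + t * H mu1 t.
have hE t : `]0, 1[%classic t ->
    Rintegral (interp_meas mu0 mu1 t) [set: Rd R d] (fun x => derive (z x) t 1) = h t.
  rewrite /= in_itv/= => /andP[t0 t1].
  have iz m : locfin m -> m.-integrable setT (EFin \o (fun x : Rd R d => derive (z x) t 1)).
    by move=> lm; exact: (spacetime_integrable m (fun p : V * R => derive (z p.1) p.2 1) M2 r2).
  rewrite (Rintegral_interp _ _ _ _ (iz _ l0) (iz _ l1)).
  by rewrite !ger0_norm//; lra.
have ch : continuous h.
  move=> t; apply: cvgD; apply: cvgM; [|exact: cH| |exact: cH].
    by apply: cvgB; [exact: cvg_cst|exact: cvg_id].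
  exact: cvg_id.
have {}gE : g = fun t => G mu1 t - G mu0 t by apply/funext => t; exact: gE.
have cg : continuous g.
  by rewrite gE => t; apply: cvgB; exact: cG.
have ioc f : continuous f ->
    lebesgue_measure.-integrable `[0, 1]%classic (EFin \o (f : R -> R)).
  move=> cf; apply: continuous_compact_integrable; first exact: segment_compact.
  exact: continuous_subspaceT.
(* The continuity equation is integrated over the open interval, the fundamental theorem over the
   closed one. *)
have oc f : continuous f -> Rintegral lebesgue_measure `]0, 1[ f =
    Rintegral lebesgue_measure `[0, 1] (f : R -> R).
  move=> cf; rewrite Rintegral_itv_bndo_bndc ?Rintegral_itv_obnd_cbnd//.
  - apply: integrableS (ioc f cf) => //; exact: subset_itv_oc_cc.
  - apply: integrableS (ioc f cf) => //; exact: subset_itv_oo_cc.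
rewrite [X in X + _](_ : _ = Rintegral lebesgue_measure `]0, 1[ h); last first.
  by apply: eq_Rintegral => t /set_mem; exact: hE.
rewrite !oc// -RintegralD//; [|exact: ioc|exact: ioc].
pose F t := (1 - t) * G mu0 t + t * G mu1 t.
have dF t : is_derive t (1 : R) F (h t + g t).
  have d0 := dG mu0 t l0; have d1 := dG mu1 t l1.
  apply: is_derive_eq.
  rewrite /h gE /GRing.scale/=; ring.
have cF : continuous F.
  move=> t; apply: differentiable_continuous; apply/derivable1_diffP.
  exact: ex_derive.
(* [K] lies in the open strip [0 < t < 1], so the boundary terms at 0 and 1 vanish. *)
have Fz t m : ~ (0 < t < 1) -> G m t = 0.
  move=> nt; rewrite /G -[RHS](mul0r (fine (m setT))) -Rintegral_cst//.
  by apply: eq_Rintegral => x _; apply: (z0 (x, t)) => /Kt.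
rewrite /Rintegral (@continuous_FTC2 _ (fun t => h t + g t) F 0 1)//.
- rewrite /F subrr !mul0r !Fz ?mulr0 ?addr0 ?subrr//=; lra.
- by apply: continuous_subspaceT => t; apply: cvgD; [exact: ch|exact: cg].
- split; first by move=> t _; exact: ex_derive.
    by apply: cvg_at_right_filter; exact: cF.
  by apply: cvg_at_left_filter; exact: cF.
- by move=> t _; rewrite derive1E; exact: derive_val.
Qed.

End spacetime.

(** * The action functional *)

Section integral_monotone.
Local Open Scope ereal_scope.
Context {dX : measure_display} {X : measurableType dX} {R : realType}
  (mu : {measure set X -> \bar R}).

(** The integral of a nonnegative function is a supremum over simple functions below it, so
    monotonicity holds for non-measurable functions too. This is what allows bounding [phi_ext]
    along a field and [Phi] along a curve, both defined through limits or infima. *)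
Lemma le_integral_dominated (D : set X) (f g : X -> \bar R) :
  (forall x, D x -> f x <= g x) -> (forall x, D x -> 0 <= g x) ->
  \int[mu]_(x in D) f x <= \int[mu]_(x in D) g x.
Proof.
move=> fg g0.
have E (h : X -> \bar R) : \int[mu]_(x in D) h x =
    \int[mu]_x ((h \_ D)^\+ x) - \int[mu]_x ((h \_ D)^\- x).
  by rewrite [in LHS]integral_mkcond [in LHS]integralE.
rewrite (E f) (_ : \int[mu]_(x in D) g x = \int[mu]_x ((g \_ D) x)); last first.
  by rewrite integral_mkcond.
apply: (@le_trans _ _ (\int[mu]_x ((f \_ D)^\+ x))).
  by rewrite geeDl// oppe_le0 integral_ge0.
rewrite !ge0_integralTE//; last by apply: erestrict_ge0.
apply: le_ereal_sup => _ [h hf <-]; exists h => // x.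
apply: (le_trans (hf x)); rewrite funeposE !patchE.
case: ifPn => [/set_mem Dx|_]; last by rewrite maxxx.
by rewrite ge_max fg// g0.
Qed.

End integral_monotone.

Section action_density.
Context {R : realType} {d : nat}.
Local Notation V := 'rV[R]_d.
Context (p : R) (phi : R -> V -> R) (p1 : 1 < p) (adm : admissible p phi).

Let phi_ge0 rho w : 0 < rho -> 0 <= phi rho w.
Proof. by case: adm => + _; apply. Qed.

Let phi_hom rho l w : 0 < rho -> phi rho (l *: w) = `|l| `^ p * phi rho w.
Proof. by case: adm => _ [_ [+ _]]; apply. Qed.

Let phi_mid rho1 rho2 v w : 0 < rho1 -> 0 < rho2 ->
  phi (2^-1 * rho1 + 2^-1 * rho2) (2^-1 *: v + 2^-1 *: w) <=
  2^-1 * phi rho1 v + 2^-1 * phi rho2 w.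
Proof.
move=> r1 r2; case: adm => _ [+ _] => /(_ rho1 rho2 v w 2^-1 r1 r2).
have -> : 1 - 2^-1 = 2^-1 :> R by field.
by apply; lra.
Qed.

Let phi0 rho : 0 < rho -> phi rho 0 = 0.
Proof.
move=> r0; rewrite -(scale0r (0 : V)) phi_hom// normr0 powR0 ?mul0r//.
by rewrite gt_eqF// (lt_trans _ p1).
Qed.

(* [(rho, w)] is the midpoint of [(L, 2 w)] and [(2 rho - L, 0)]. *)
Lemma density_le_base L rho w : 0 < L -> L <= rho ->
  phi rho w <= 2 `^ p * phi L w.
Proof.
move=> L0 Lr; have r2 : 0 < 2 * rho - L by lra.
have := phi_mid L (2 * rho - L) (2 *: w) 0 L0 r2.
rewrite (phi0 _ r2) scaler0 addr0 mulr0 addr0 scalerA mulVf// scale1r.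
rewrite (_ : 2^-1 * L + _ = rho); last by field.
rewrite phi_hom// ger0_norm// => /le_trans; apply.
by rewrite ler_piMl ?mulr_ge0 ?powR_ge0 ?phi_ge0//; lra.
Qed.

(** [(L, v + w)] is the midpoint of [(L, 2 v)] and [(L, 2 w)]; homogeneity turns the doubling into
    [2^p]. *)
Lemma densityD_le L v w : 0 < L ->
  phi L (v + w) <= 2 `^ p * (phi L v + phi L w).
Proof.
move=> L0; have := phi_mid L L (2 *: v) (2 *: w) L0 L0.
rewrite !scalerA !mulVf// !scale1r (_ : 2^-1 * L + _ = L); last by field.
rewrite !phi_hom// ger0_norm// => /le_trans; apply.
rewrite -!mulrDr ler_piMl ?mulr_ge0 ?powR_ge0 ?addr_ge0 ?phi_ge0//; lra.
Qed.

(** Coordinates are added one at a time by [densityD_le], and homogeneity extracts [|w_i|^p] from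
    each. *)
Lemma density_le_sum L (s : seq 'I_d) : 0 < L -> exists C, 0 <= C /\ forall w : V,
  phi L (\sum_(i <- s) w ord0 i *: delta_mx ord0 i) <=
  C * \sum_(i <- s) `|w ord0 i| `^ p.
Proof.
move=> L0; elim: s => [|j s [C [C0 IH]]].
  by exists 0; split => // w; rewrite !big_nil phi0// mulr0.
have P0 : 0 <= 2 `^ p * (phi L (delta_mx ord0 j) + C).
  by rewrite mulr_ge0 ?powR_ge0 ?addr_ge0 ?phi_ge0.
exists (2 `^ p * (phi L (delta_mx ord0 j) + C)); split => // w.
rewrite !big_cons; apply: (le_trans (densityD_le _ _ _ L0)).
rewrite -mulrA ler_wpM2l ?powR_ge0// phi_hom//.
have := IH w; have := phi_ge0 L (delta_mx ord0 j) L0.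
have := powR_ge0 `|w ord0 j| p.
have : 0 <= \sum_(i <- s) `|w ord0 i| `^ p by apply: sumr_ge0 => i _; exact: powR_ge0.
move: (phi L _) (phi L _) (_ `^ p) (\sum_(i <- s) _) => a b x y y0 x0 b0 IHw.
nra.
Qed.

Lemma density_upper_bound L : 0 < L -> exists C, 0 < C /\
  forall rho (w : V), L <= rho -> phi rho w <= C * \sum_(i < d) `|w ord0 i| `^ p.
Proof.
move=> L0; have [C [C0 HC]] := density_le_sum L (index_enum 'I_d) L0.
exists (2 `^ p * (C + 1)); split; first by rewrite mulr_gt0 ?powR_gt0//; lra.
move=> rho w Lr; apply: (le_trans (density_le_base _ _ _ L0 Lr)).
rewrite -mulrA ler_wpM2l ?powR_ge0//.
rewrite {1}(row_sum_delta w); apply: (le_trans (HC w)).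
by rewrite ler_wpM2r ?lerDl//; apply: sumr_ge0 => i _; exact: powR_ge0.
Qed.

Let lim_ge0 {T : Type} (F : set_system T) {FF : ProperFilter F} (f : T -> \bar R) :
  (\forall x \near F, 0 <= f x)%E -> (0 <= lim (f @ F))%E.
Proof.
(* If the limit does not exist, [lim] is the default point [0] of the extended reals. *)
move=> f0; have [cf|ncf] := pselect (cvg (f @ F)); first exact: lime_ge.
by rewrite (dvgP ncf).
Qed.

Lemma phi_ext_ge0 rho w : (0 <= phi_ext phi rho w)%E.
Proof.
rewrite /phi_ext; case: ifPn => [r0|_]; first by rewrite lee_fin phi_ge0.
by apply: lim_ge0; near=> r; rewrite lee_fin phi_ge0.
Unshelve. all: by end_near. Qed.

Lemma phi_rec_ge0 rho w : (0 <= phi_rec phi rho w)%E.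
Proof.
rewrite /phi_rec; apply: lim_ge0; near=> l.
apply: mule_ge0; last exact: phi_ext_ge0.
by rewrite lee_fin invr_ge0 ltW//; near: l; exact: nbhs_pinfty_gt.
Unshelve. all: by end_near. Qed.

(** Needed because the power [1 / p] in [Wdist] is monotone only on nonnegative values. *)
Lemma Phi_ge0 (gamma mu : {measure set (Rd R d) -> \bar R}) nu :
  (0 <= Phi phi gamma mu nu)%E.
Proof.
rewrite /Phi; case: ifPn => _; last exact: leey.
apply: le_ereal_inf_tmp => _ [rho [w [rhop [wp [sigma [_ ->]]]]]].
by apply: adde_ge0; apply: integral_ge0 => x _; [exact: phi_ext_ge0|exact: phi_rec_ge0].
Qed.

End action_density.

Lemma lebesgue_measure_oitv1 (R : realType) :
  lebesgue_measure (oitv (1 : R)) = 1%E.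
Proof.
have := @lebesgue_measure_itv R `]0, 1[; rewrite /= lte01 -EFinB subr0.
exact.
Qed.

(** * The constant-flux competitor and its action *)

Section assembly.
Context {R : realType} {d : nat}.
Local Notation V := 'rV[R]_d.
Local Notation meas := {measure set (Rd R d) -> \bar R}.

Definition row_field (w : 'I_d -> Rd R d -> R) (x : V) : V := \row_i w i x.

(** From [|t| <= 1 + |t|^p] in each component; hence finite [p]-energy and local finiteness of
    [gamma] make the flux locally integrable. *)
Lemma enorm_row_field_le p (w : 'I_d -> Rd R d -> R) x : 1 < p ->
  enorm (row_field w x) <= d%:R + powsum p w x.
Proof.
move=> p1; apply: (le_trans (enorm_le_sum _)).
have -> : d%:R + powsum p w x = \sum_(i < d) (1 + `|w i x| `^ p).
  by rewrite big_split/= sumr_const card_ord.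
apply: ler_sum => i _; rewrite mxE.
have := powR_young_le p 1 `|w i x| p1 ler01 (normr_ge0 _).
by rewrite !powR1 mul1r.
Qed.

Section constant_flow.
Context (p : R) (p1 : 1 < p) (gamma mu0 mu1 : meas).
Context (lg : locfin gamma) (l0 : locfin mu0) (l1 : locfin mu1).
Context (w : 'I_d -> Rd R d -> R) (mw : forall i, measurable_fun setT (w i)).
Context (iw : (\int[gamma]_x (powsum p w x)%:E < +oo)%E).

Lemma row_field_coord_measurable i :
  measurable_fun [set: Rd R d] (fun x : Rd R d => row_field w x ord0 i).
Proof. by under eq_fun do rewrite mxE; exact: mw. Qed.

Lemma row_field_locally_integrable r :
  (\int[gamma]_(x in eball (0 : V) r) (enorm (row_field w x))%:E < +oo)%E.
Proof.
have mB := measurable_eball (R := R) (d := d) r.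
have mP := measurable_powsum p w mw.
apply: (@le_lt_trans _ _ (\int[gamma]_(x in eball (0 : V) r) (d%:R%:E + (powsum p w x)%:E))%E).
  apply: le_integral_dominated => x _; first by rewrite -EFinD lee_fin enorm_row_field_le.
  by rewrite adde_ge0 ?lee_fin ?ler0n ?powsum_ge0.
rewrite ge0_integralD//; last 2 first.
- by move=> x _; rewrite lee_fin powsum_ge0.
- by apply/measurable_EFinP; exact: measurable_funTS.
apply: lte_add_pinfty.
  by rewrite integral_cst//; apply: lte_mul_pinfty; rewrite ?lee_fin//; exact: lg.
apply: le_lt_trans iw; apply: ge0_subset_integral => //.
  exact/measurable_EFinP.
by move=> x _; rewrite lee_fin powsum_ge0.
Qed.

Definition field_vmeas : vmeas R d :=
  @VMeas R d gamma (row_field w) row_field_coord_measurable row_field_locally_integrable.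

Lemma vint_field_vmeas f :
  vint field_vmeas (fun x => grad f x) =
  \int[gamma]_x duality_pairing w (fun i (x : Rd R d) => pd f i x) x.
Proof.
rewrite /vint; apply: eq_Rintegral => x _; apply: eq_bigr => i _.
by rewrite !mxE.
Qed.

Lemma locfin_interp t : locfin (interp_meas mu0 mu1 t).
Proof.
by move=> r; rewrite interp_measE; apply: lte_add_pinfty; apply: lte_mul_pinfty.
Qed.

Lemma constant_flow_CE :
  (forall f, C1c f -> Rintegral mu1 [set: Rd R d] f - Rintegral mu0 [set: Rd R d] f =
      vint field_vmeas (fun x => grad f x)) ->
  CE_ends 1 (interp_meas mu0 mu1) (fun _ => field_vmeas) mu0 mu1.
Proof.
move=> Hw; split; last first.
  split => A mA; rewrite interp_measE.
    by rewrite subr0 normr1 normr0 mul1e mul0e adde0.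
  by rewrite subrr normr1 normr0 mul1e mul0e add0e.
split; first by move=> t _; exact: locfin_interp.
split.
  move=> f Cf; apply: continuous_subspaceT => t.
  have E s : Rintegral (interp_meas mu0 mu1 s) [set: Rd R d] f =
      `|1 - s| * Rintegral mu0 [set: Rd R d] f + `|s| * Rintegral mu1 [set: Rd R d] f.
    by apply: Rintegral_interp; exact: Cc_integrable.
  under eq_fun do rewrite E.
  apply: cvgD.
    apply: cvgM; last exact: cvg_cst.
    by apply: cvg_norm; apply: cvgB; [exact: cvg_cst|exact: cvg_id].
  by apply: cvgM; [exact: norm_continuous|exact: cvg_cst].
split; first by move=> f _; exact: measurable_cst.
split.
  move=> r; rewrite integral_cst; last exact: measurable_itv.
  apply: lte_mul_pinfty.
  - by apply: integral_ge0 => x _; rewrite lee_fin enorm_ge0.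
  - rewrite ge0_fin_numE; first exact: row_field_locally_integrable.
    by apply: integral_ge0 => x _; rewrite lee_fin enorm_ge0.
  - by rewrite /= lebesgue_measure_oitv1 ltry.
move=> z Cz; apply: interp_continuity_equation => // t.
by rewrite Hw//; exact: C1c_st_section Cz.
Qed.

Context (phi : R -> V -> R) (L C : R) (L0 : 0 < L) (C0 : 0 < C).
Context (phiC : forall rho (v : V), L <= rho ->
  phi rho v <= C * \sum_(i < d) `|v ord0 i| `^ p).
Context (s0 s1 : Rd R d -> R) (ms0 : measurable_fun setT s0) (ms1 : measurable_fun setT s1).
Context (s0E : forall A, measurable A -> mu0 A = (\int[gamma]_(x in A) (s0 x)%:E)%E).
Context (s1E : forall A, measurable A -> mu1 A = (\int[gamma]_(x in A) (s1 x)%:E)%E).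
Context (s0L : {ae gamma, forall x, L <= s0 x}) (s1L : {ae gamma, forall x, L <= s1 x}).

(** Truncation at [L] changes [s0] and [s1] only on a [gamma]-null set and makes the lower bound
    hold everywhere, as [lebdec] asks for a density that is nonnegative at every point. *)
Definition interp_density t (x : Rd R d) : R :=
  (1 - t) * Num.max L (s0 x) + t * Num.max L (s1 x).

Lemma measurable_interp_density t : measurable_fun setT (interp_density t).
Proof.
by apply: measurable_funD; apply: measurable_funM => //; exact: measurable_maxr.
Qed.

Lemma interp_density_ge t x : 0 <= t <= 1 -> L <= interp_density t x.
Proof.
move=> t01; rewrite /interp_density.
have : L <= Num.max L (s0 x) by rewrite le_max lexx.
have : L <= Num.max L (s1 x) by rewrite le_max lexx.
move: (Num.max _ _) (Num.max _ _) => a b; nra.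
Qed.

Lemma truncated_density m (s : Rd R d -> R) : measurable_fun setT s ->
  (forall A, measurable A -> m A = (\int[gamma]_(x in A) (s x)%:E)%E) ->
  {ae gamma, forall x, L <= s x} ->
  forall A, measurable A -> m A = (\int[gamma]_(x in A) (Num.max L (s x))%:E)%E.
Proof.
move=> ms sE sL A mA; rewrite sE//; apply: ae_eq_integral => //.
- by apply/measurable_EFinP; exact: measurable_funTS.
- by apply/measurable_EFinP; apply: measurable_funTS; exact: measurable_maxr.
- by apply: filterS sL => x Lx _; rewrite (max_idPr Lx).
Qed.

Lemma interp_measE_density t A : 0 <= t <= 1 -> measurable A ->
  interp_meas mu0 mu1 t A = (\int[gamma]_(x in A) (interp_density t x)%:E)%E.
Proof.
move=> /andP[t0 t1] mA.
have mm s : measurable_fun setT s ->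
    measurable_fun A (fun x : Rd R d => (Num.max L (s x))%:E).
  by move=> ms; apply/measurable_EFinP; apply: measurable_funTS; exact: measurable_maxr.
have m0 (s : Rd R d -> R) x : (0 <= (Num.max L (s x))%:E)%E.
  by rewrite lee_fin le_max ltW.
rewrite interp_measE (truncated_density _ _ ms0 s0E s0L _ mA)
  (truncated_density _ _ ms1 s1E s1L _ mA).
rewrite !ger0_norm ?subr_ge0//.
under [RHS]eq_integral do rewrite EFinD !EFinM.
rewrite ge0_integralD//; last 4 first.
- by move=> x _; rewrite mule_ge0// lee_fin subr_ge0.
- by apply: measurable_funeM; exact: mm.
- by move=> x _; rewrite mule_ge0// lee_fin.
- by apply: measurable_funeM; exact: mm.
by rewrite !ge0_integralZl ?lee_fin ?subr_ge0//; exact: mm.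
Qed.

Lemma Phi_interp_le t : 0 <= t <= 1 ->
  (Phi phi gamma (interp_meas mu0 mu1 t) field_vmeas <=
   C%:E * \int[gamma]_x (powsum p w x)%:E)%E.
Proof.
move=> t01; rewrite /Phi asboolT; last first.
  (* Support condition: the curve and the flux have densities with respect to [gamma], so they give
     no mass to a [gamma]-null ball. *)
  have null (x : V) e : ~ (0 < gamma (eball x e))%E -> gamma (eball x e) = 0%E.
    by move=> /negP; rewrite -leNgt measure_le0 => /eqP.
  have mB (x : V) e : measurable (eball x e).
    have -> : eball x e = [set: Rd R d] `&`
        ((fun y : Rd R d => enorm ((y : V) - x)) : Rd R d -> R) @^-1` `]-oo, e[%classic.
      by rewrite setTI; apply/seteqP; split => y; rewrite /eball/= in_itv.
    have mE : measurable_fun [set: Rd R d] (fun y : Rd R d => enorm ((y : V) - x)).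
      apply: continuous_measurable_Rd => y.
      apply: (continuous_comp (f := fun y : V => y - x) (g := @enorm R d)).
        exact: (@cvgB R V _ (nbhs y) _ id (cst x) y x cvg_id (cvg_cst x)).
      exact: continuous_enorm.
    by apply: mE => //; exact: measurable_itv.
  have mid : measurable_fun setT (EFin \o interp_density t).
    by apply/measurable_EFinP; exact: measurable_interp_density.
  have mnu : measurable_fun setT (fun x : Rd R d => (enorm (row_field w x))%:E).
    apply/measurable_EFinP.
    apply: (@measurableT_comp _ _ _ _ _ _ (@Num.sqrt R)).
      exact: continuous_measurable_fun (@sqrt_continuous R).
    by apply: measurable_sum => i; apply: measurable_funM; exact: row_field_coord_measurable.
  split=> x sx e e0; apply: contrapT => /null ne; have := sx e e0.
    rewrite interp_measE_density// null_set_integral ?ltxx//.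
    exact: measurable_funTS.
  by rewrite /tv null_set_integral ?ltxx//; exact: measurable_funTS.
pose rho := interp_density t.
(* [Phi] is an infimum over decompositions; the one whose singular part lives on the zero measure
   has no recession term. *)
apply: (@le_trans _ _ (\int[gamma]_(x in [set: Rd R d]) phi_ext phi (rho x) (row_field w x) +
   \int[mzero]_(x in [set: Rd R d]) phi_rec phi 0 0)%E).
  apply: ereal_inf_lbound.
  exists rho, (row_field w), (fun _ => 0), (fun _ => 0), mzero; split => //.
  have rho0 x : 0 <= rho x by rewrite (le_trans (ltW L0))// interp_density_ge.
  split; first by move=> r; exact: ltry.
  split; first exact: measurable_interp_density.
  split; first exact: rho0.
  split; first exact: measurable_cst.
  split; first by [].
  split; first exact: row_field_coord_measurable.
  split; first by move=> i; under eq_fun do rewrite mxE; exact: measurable_cst.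
  split; first exact: row_field_locally_integrable.
  split; first by move=> r; rewrite integral_measure_zero.
  split; first by move=> A mA; rewrite integral_measure_zero adde0 interp_measE_density.
  split; first by move=> f _; rewrite [X in _ + X]/Rintegral integral_measure_zero/= addr0.
  by exists set0; split => //; split; [exact: measure0|rewrite integral_measure_zero].
rewrite integral_measure_zero adde0 -ge0_integralZl//; last 3 first.
- by apply/measurable_EFinP; exact: measurable_powsum.
- by move=> x _; rewrite lee_fin powsum_ge0.
- by rewrite lee_fin ltW.
apply: le_integral_dominated => x _; last first.
  by rewrite mule_ge0 ?lee_fin ?powsum_ge0// ltW.
have Lrho := interp_density_ge t x t01.
rewrite /phi_ext (lt_le_trans L0)// -EFinM lee_fin (le_trans (phiC _ _ Lrho))//.
by rewrite /powsum; under eq_bigr do rewrite mxE.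
Qed.

Lemma action_le : (\int[lebesgue_measure]_(t in oitv (1 : R))
    Phi phi gamma (interp_meas mu0 mu1 t) field_vmeas <=
  C%:E * \int[gamma]_x (powsum p w x)%:E)%E.
Proof.
set B := (C%:E * _)%E.
have B0 : (0 <= B)%E.
  by rewrite mule_ge0 ?lee_fin ?(ltW C0)//; apply: integral_ge0 => x _; rewrite lee_fin powsum_ge0.
apply: (@le_trans _ _ (\int[lebesgue_measure]_(t in oitv (1 : R)) B)%E).
  apply: le_integral_dominated => // t; rewrite /oitv/= in_itv/= => /andP[t0 t1].
  by apply: Phi_interp_le; rewrite !ltW.
rewrite integral_cst; last exact: measurable_itv.
by rewrite /= lebesgue_measure_oitv1 mule1.
Qed.

End constant_flow.

Lemma Wdist_le p (phi : R -> V -> R) (gamma mu0 mu1 : meas) (mu : R -> meas)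
    (nu : R -> vmeas R d) (A : R) : 1 < p -> admissible p phi ->
  CE_ends 1 mu nu mu0 mu1 ->
  (\int[lebesgue_measure]_(t in oitv (1 : R)) Phi phi gamma (mu t) (nu t) <= A%:E)%E ->
  (Wdist p phi gamma mu0 mu1 <= (A `^ p^-1)%:E)%E.
Proof.
move=> p1 adm ce HA; rewrite /Wdist.
set S := (X in ereal_inf X).
have S0 : (0 <= ereal_inf S)%E.
  apply: le_ereal_inf_tmp => _ [m [n [_ ->]]].
  by apply: integral_ge0 => t _; exact: (Phi_ge0 p).
have SA : (ereal_inf S <= A%:E)%E.
  by apply: le_trans HA; apply: ereal_inf_lbound; exists mu, nu.
rewrite -poweR_EFin; apply: gt0_ler_poweR => //.
- by rewrite invr_ge0 ltW// (lt_trans _ p1).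
- by rewrite in_itv/= S0 leey.
- by rewrite in_itv/= (le_trans S0 SA) leey.
Qed.

End assembly.

Theorem mainTheorem17 (R : realType) (d : nat) (p : R)
    (phi : R -> 'rV[R]_d -> R) (L : R) :
  1 < p -> admissible p phi -> 0 < L ->
  exists C : R, 0 < C /\
  forall (gamma mu0 mu1 : {measure set Rd R d -> \bar R}) (s0 s1 : Rd R d -> R),
    locfin gamma -> locfin mu0 -> locfin mu1 ->
    measurable_fun [set: Rd R d] s0 -> measurable_fun [set: Rd R d] s1 ->
    (forall A, measurable A -> mu0 A = (\int[gamma]_(x in A) (s0 x)%:E)%E) ->
    (forall A, measurable A -> mu1 A = (\int[gamma]_(x in A) (s1 x)%:E)%E) ->
    {ae gamma, forall x, L <= s0 x} ->
    {ae gamma, forall x, L <= s1 x} ->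
    (Wdist p phi gamma mu0 mu1 <= C%:E * dualnorm (p / (p - 1)) gamma mu0 mu1)%E.
Proof.
move=> p1 adm L0.
have [C [C0 HC]] := density_upper_bound p phi p1 adm L L0.
have p0 : 0 < p by rewrite (lt_trans _ p1).
have p10 : 0 < p - 1 by rewrite subr_gt0.
pose q := p / (p - 1).
have q1 : 1 < q by rewrite ltr_pdivlMr// mul1r ltrBlDr ltrDl.
have qp : q / (q - 1) = p by rewrite /q; field; rewrite !gt_eqF//; lra.
(* The factor from [dual_vector_field], where [q / (q - 1) = p]. *)
pose E := q `^ p * (2 * q / (q - 1)).
have q0 : 0 < q by rewrite (lt_trans _ q1).
have E0 : 0 < E by rewrite !mulr_gt0 ?powR_gt0 ?invr_gt0 ?subr_gt0.
have d0 : 0 < d.+1%:R :> R by rewrite ltr0n.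
(* Chosen so that [K * D] is the [p]-th root of the action bound [C * ((d + 1) * D)^p * E]. *)
pose K := (C * E) `^ p^-1 * d.+1%:R.
have K0 : 0 < K by rewrite mulr_gt0// powR_gt0// mulr_gt0.
exists K; split => // gamma mu0 mu1 s0 s1 lg l0 l1 ms0 ms1 s0E s1E s0L s1L.
have Wle D : 0 < D -> (dualnorm q gamma mu0 mu1 <= D%:E)%E ->
    (Wdist p phi gamma mu0 mu1 <= (K * D)%:E)%E.
  move=> D0 HD.
  have [w [mw iw Hw]] := dual_vector_field q D gamma mu0 mu1 q1 D0 lg l0 l1 HD.
  rewrite qp in iw.
  have iw' := le_lt_trans iw (ltry _).
  have ce := constant_flow_CE p p1 gamma mu0 mu1 lg l0 l1 w mw iw'.
  have act := action_le p p1 gamma mu0 mu1 lg w mw iw' phi L C L0 C0 HC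
    s0 s1 ms0 ms1 s0E s1E s0L s1L.
  have -> : K * D = ((C * (((d.+1%:R * D) `^ p) * E)) `^ p^-1).
    have CE0 : 0 <= C * E by rewrite ltW// mulr_gt0.
    rewrite mulrCA [in RHS](powRM _ (powR_ge0 _ _) CE0).
    rewrite -powRrM mulfV ?gt_eqF// powRr1; last by rewrite mulr_ge0// ltW.
    by rewrite /K -mulrA mulrC.
  apply: (Wdist_le p phi gamma mu0 mu1 (interp_meas mu0 mu1)
    (fun _ => field_vmeas p p1 gamma lg w mw iw')) => //.
    apply: ce => f Cf; rewrite Hw//.
    by rewrite vint_field_vmeas.
  apply: (le_trans act); rewrite [leRHS]EFinM lee_wpmul2l ?lee_fin ?(ltW C0)//.
(* The zero test function rules out the value [-oo]. *)
have N0 : (0 <= dualnorm q gamma mu0 mu1)%E.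
  apply: ereal_sup_ubound; exists (fun _ => 0).
    split; first exact: C1c0.
    rewrite (_ : (fun x => _) = cst 0%E) ?integral0//; apply/funext => x /=.
    rewrite (_ : enorm _ = 0) ?powR0 ?gt_eqF//.
    rewrite /enorm /dotv big1 ?sqrtr0// => i _.
    by rewrite mxE /pd (derive_cst (0 : R^o)) mulr0.
  by rewrite !Rintegral_cst// !mul0r subrr.
case Nq : (dualnorm q gamma mu0 mu1) N0 Wle => [r| |]// r0 Wle.
  (* The norm [r] may be 0 while [Wle] takes a positive [D]; it is applied to [r + e / K], with [e]
     arbitrary. *)
  apply/lee_addgt0Pr => e e0.
  have eK : 0 < e / K by rewrite divr_gt0.
  rewrite lee_fin in r0.
  have := Wle (r + e / K); rewrite lee_fin lerDl (ltW eK) => /(_ _ isT).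
  rewrite mulrDr [K * (e / K)]mulrCA mulfV ?gt_eqF// mulr1; apply.
  by rewrite ltr_wpDl.
by rewrite mulry gtr0_sg// mul1e leey.
Qed.
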